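(* There exists a universal constant $B>0$ such that the following holds. Let $n\ge1$ and let $\sigma\in\{0,1\}^n$ be distributed according to the Gibbs measure of the imitative monomer-dimer model (in its weighted Curie--Weiss form) with parameters $(J,h)=(J_c,h_c)$, and let $m(\sigma)=(\sigma_1+\cdots+\sigma_n)/n$. Then for every real $p\ge3$ and all $z\in\mathbb{R}$, $$\left|\mathbb{P}\left(n^{1/4}(m(\sigma)-m_c)\le z\right)-\mathbb{P}(Y\le z)\right|\le\frac{B^p\,p^{p/2}}{(1+|z|)^p\,n^{1/4}},$$ where $Y$ is a random variable with probability density function $p(x)=Ke^{-\lambda_cx^4/24}$, $x\in\mathbb{R}$, $K$ being the normalizing constant.
   Context: Let $V=\{1,\ldots,n\}$ and let $E=\{\{u,v\}:u,v\in V,\ u<v\}$ be the edge set of the complete graph on $V$. A dimer configuration is a set $D\subseteq E$ of pairwise nonincident edges (a matching, possibly empty); its monomer set $\mathcal{M}(D)$ is the set of vertices not covered by any edge of $D$. For $\sigma=(\sigma_1,\ldots,\sigma_n)\in\Sigma=\{0,1\}^n$, let $\mathcal{A}(\sigma)=\{i\in V:\sigma_i=1\}$ and let $D(\sigma)$ be the number of dimer configurations $D$ with $\mathcal{M}(D)=\mathcal{A}(\sigma)$. For an imitation coefficient $J\ge0$ and external field $h\in\mathbb{R}$, define the Hamiltonian by $$-H(\sigma)=n\left(J\,m(\sigma)^2+\left(\frac{\log n}{2}+h-J\right)m(\sigma)\right),\qquad m(\sigma)=\frac{\sigma_1+\cdots+\sigma_n}{n},$$ and the Gibbs measure by $$\mathbb{P}(\sigma)=\frac{D(\sigma)\exp(-H(\sigma))}{\sum_{\tau\in\Sigma}D(\tau)\exp(-H(\tau))}.$$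 The critical parameters are $$J_c=\frac{1}{4(3-2\sqrt2)},\qquad h_c=\frac{\log(12-8\sqrt2)-1}{4},\qquad m_c=2-\sqrt2.$$ With $J=J_c$ and $h=h_c$, let $$\tilde p(x)=-Jx^2-\frac12\Big(1-g(\tau(x))+\log\big(1-g(\tau(x))\big)\Big),\quad g(x)=\frac12\left(\sqrt{e^{4x}+4e^{2x}}-e^{2x}\right),\quad \tau(x)=(2x-1)J+h,$$ and $\lambda_c=-\tilde p^{(4)}(m_c)$, where $\tilde p^{(4)}$ is the fourth derivative; it is known that $\lambda_c>0$. A universal constant is one not depending on $n$, $p$, $z$. *)

(* Defs.v *)
From HB Require Import structures.
From mathcomp Require Export all_boot all_order all_algebra.
From mathcomp Require Export all_classical all_reals all_analysis.
Export Order.TTheory GRing.Theory Num.Theory.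
Export numFieldNormedType.Exports.

Set Implicit Arguments.
Unset Strict Implicit.
Unset Printing Implicit Defensive.

(* The vertex set {1, ..., n} is encoded as 'I_n, an edge as a two-element
   {set 'I_n}, and a configuration in {0,1}^n as a boolean function. *)
Definition config (n : nat) := {ffun 'I_n -> bool}.

Definition edges (n : nat) : {set {set 'I_n}} :=
  [set e : {set 'I_n} | #|e| == 2%N].

Definition is_dimer_config (n : nat) (D : {set {set 'I_n}}) : bool :=
  (D \subset edges n) && finset.trivIset D.

Definition monomers (n : nat) (D : {set {set 'I_n}}) : {set 'I_n} := ~: finset.cover D.

Definition monomer_support (n : nat) (s : config n) : {set 'I_n} :=
  [set i | s i].

Definition num_dimer_configs (n : nat) (s : config n) : nat :=
  #|[set D : {set {set 'I_n}} |
      is_dimer_config D && (monomers D == monomer_support s)]|.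

Local Open Scope classical_set_scope.
Local Open Scope ring_scope.

Section Model.
Variable R : realType.

Definition magnetization (n : nat) (s : config n) : R :=
  (\sum_(i < n) (s i)%:R) / n%:R.

(* This is -H, the exponent of the Boltzmann weight. *)
Definition neg_hamiltonian (n : nat) (J h : R) (s : config n) : R :=
  n%:R * (J * magnetization s ^+ 2
          + (ln n%:R / 2 + h - J) * magnetization s).

Definition boltzmann_weight (n : nat) (J h : R) (s : config n) : R :=
  (num_dimer_configs s)%:R * expR (neg_hamiltonian J h s).

Definition gibbs (n : nat) (J h : R) (s : config n) : R :=
  boltzmann_weight J h s / \sum_(t : config n) boltzmann_weight J h t.

Definition gibbs_prob (n : nat) (J h : R) (E : pred (config n)) : R :=
  \sum_(s : config n | E s) gibbs J h s.

Definition J_c : R := 1 / (4 * (3 - 2 * Num.sqrt 2)).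
Definition h_c : R := (ln (12 - 8 * Num.sqrt 2) - 1) / 4.
Definition m_c : R := 2 - Num.sqrt 2.

Definition g (x : R) : R :=
  (Num.sqrt (expR (4 * x) + 4 * expR (2 * x)) - expR (2 * x)) / 2.

Definition tau (J h x : R) : R := (2 * x - 1) * J + h.

Definition p_tilde (J h x : R) : R :=
  - J * x ^+ 2 - (1 - g (tau J h x) + ln (1 - g (tau J h x))) / 2.

Definition lambda_c : R := - derive1n 4 (p_tilde J_c h_c) m_c.

Definition quartic_weight (x : R) : R := expR (- lambda_c * x ^+ 4 / 24).

Definition quartic_const : R :=
  (\int[lebesgue_measure]_(x in [set: R]) quartic_weight x)^-1.

Definition quartic_density (x : R) : R := quartic_const * quartic_weight x.

Definition has_density (d : measure_display) (T : measurableType d)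
    (P : probability T R) (Y : {RV P >-> R}) (f : R -> R) : Prop :=
  forall A : set R, measurable A ->
    distribution P Y A = (\int[lebesgue_measure]_(x in A) (f x)%:E)%E.

End Model.

Arguments J_c {R}.
Arguments h_c {R}.
Arguments m_c {R}.

(* Main.v *)
Require Import Defs.
From mathcomp Require Import measurable_realfun ring lra zify.
Set Implicit Arguments.
Unset Strict Implicit.
Unset Printing Implicit Defensive.

(** Only the number k of monomers matters, and its law is explicit: by symmetry
    and because a set of even size r has (r - 1)!! perfect matchings, k carries
    a weight W(k), supported on k = n mod 2, that is proportional to
    C(n, k) (n - k - 1)!! times the Boltzmann factor. Hence the ratio of
    consecutive weights is elementary,
      W(k + 2) / W(k)
        = n (n - k) / ((k + 1) (k + 2)) exp (4 J (k + 1) / n + 2 (h - J)),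
    and equals exp (drift (k / n) + O(1 / n)) away from the end points, where
      drift x = ln (1 - x) - 2 ln x + 4 J x + 2 (h - J).
    At the critical parameters drift vanishes at m_c and its derivative is
    - 4 J (x - m_c)^2 / (x (1 - x)) (der_drift). So drift is nonincreasing, and
    drift (m_c + t) = - (lambda_c / 3) t^3 + O(t^4) (drift_cubic), because
    lambda_c = 4 J / (m_c (1 - m_c)) (lambda_cE).

    Put s = n^(-1/4). In the variable w = (k / n - m_c) / s the weights live on
    a grid of mesh 2 s^3 = 2 n^(-3/4), and the ratio of exp (- lambda_c w^4 / 24)
    at two neighbouring grid points is exp (- (lambda_c / 3) t^3 + ...) with
    t = s w. Multiplying ratios outwards from m_c shows that
    the normalised weight at w equals exp (- lambda_c w^4 / 24) up to a factor
    exp (O(s (w + w^5))) as long as s w is small; beyond that range the weights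
    are quasi-decreasing, hence exponentially small in n. Both regimes are
    subsumed by the single bound C s exp (- 2 w^2 - w) on the difference
    (one_sided_comparison). Neither the factorials nor the normalising constant
    has to be estimated.

    On the other side, the probability that Y falls in a cell of the grid lies
    between K times the mesh times the values of exp (- lambda_c w^4 / 24) at
    the two ends of the cell, and these errors telescope. Summing over the cells
    beyond z gives |sum of weights beyond z - tail of Y at z| <= C s exp (- z^2)
    (tail_comparison), for each of the two tails, after multiplication of the
    weights by K times the mesh. As the two tails of Y at 0 add up to 1, the
    same estimate at z = 0 controls the partition function (weights_vs_tails).

    This yields |F_n(z) - F(z)| <= C n^(-1/4) exp (- z^2), which is stronger than
    the required polynomial bounds: optimising (1 + |z|)^p exp (- z^2) over z
    produces the factor B^p p^(p/2) (gaussian_power_bound). *)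

(** * Counting dimer configurations with prescribed monomers *)

Module DimerCounting.
Import mathcomp.boot.fintype mathcomp.boot.finset.
Local Open Scope nat_scope.

(** Number of perfect matchings of a set with m elements: the double factorial
    (m - 1)!! when m is even, and 0 when m is odd. *)
Fixpoint num_perfect_matchings (m : nat) : nat :=
  match m with
  | 0 => 1
  | 1 => 0
  | S (S m' as m1) => m1 * num_perfect_matchings m'
  end.

Lemma num_perfect_matchingsSS m :
  num_perfect_matchings m.+2 = m.+1 * num_perfect_matchings m.
Proof. by []. Qed.

Lemma num_perfect_matchings_odd m : odd m -> num_perfect_matchings m = 0.
Proof.
elim/ltn_ind: m => -[|[|m]] IH //; rewrite num_perfect_matchingsSS => om.
by rewrite IH ?muln0 //; move: om; rewrite /= negbK.
Qed.

Lemma num_perfect_matchings_gt0 m : ~~ odd m -> 0 < num_perfect_matchings m.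
Proof.
elim/ltn_ind: m => -[|[|m]] IH //; rewrite num_perfect_matchingsSS => om.
by rewrite muln_gt0 /= IH //; move: om; rewrite /= negbK.
Qed.

(** The dimer configurations whose edges cover exactly the vertices of S. *)
Definition perfect_matchings n (S : {set 'I_n}) : {set {set {set 'I_n}}} :=
  [set D | is_dimer_config D && (cover D == S)].

Lemma perfect_matchings0 n : perfect_matchings (set0 : {set 'I_n}) = [set set0].
Proof.
apply/setP => D; rewrite !inE; apply/idP/idP.
  move=> /andP[/andP[/subsetP De _] /eqP cD].
  apply/eqP/setP => e; rewrite inE; apply/negP => eD.
  have := De _ eD; rewrite inE => /eqP e2.
  have : e \subset cover D by apply: bigcup_sup eD.
  by rewrite cD subset0 => /eqP e0; rewrite e0 cards0 in e2.
move=> /eqP ->; rewrite /is_dimer_config sub0set /= /cover big_set0 eqxx.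
by rewrite andbT /trivIset /cover !big_set0 cards0.
Qed.

(** Removing the edge {x, y} is a bijection from the perfect matchings of S
    that contain it onto the perfect matchings of S minus {x, y}. *)
Lemma card_perfect_matchings_edge n (S : {set 'I_n}) x y :
  x \in S -> y \in S :\ x ->
  #|[set D in perfect_matchings S | [set x; y] \in D]| =
  #|perfect_matchings (S :\: [set x; y])|.
Proof.
move=> xS; rewrite !inE => /andP[yx yS].
set e := [set x; y].
have e2 : #|e| = 2 by rewrite cards2 eq_sym yx.
have eS : e \subset S by apply/subsetP => z; rewrite !inE => /orP[/eqP->|/eqP->].
have notin D : cover D \subset S :\: e -> e \notin D.
  move=> cD; apply/negP => eD.
  have : e \subset S :\: e by apply: subset_trans cD; apply: bigcup_sup eD.
  by move=> /subsetP /(_ x); rewrite !inE eqxx /= => /(_ isT).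
rewrite -[RHS](card_in_imset (f := fun D => e |: D)); last first.
  move=> D1 D2; rewrite !inE => /andP[_ /eqP c1] /andP[_ /eqP c2] E.
  by rewrite -(setU1K (notin D1 _)) ?c1 // E setU1K // notin ?c2.
apply: eq_card => D; rewrite !inE; apply/idP/imsetP.
  move=> /andP[/andP[/andP[De tD] /eqP cD] eD].
  exists (D :\ e); last by rewrite setD1K.
  rewrite inE coverD1 // cD eqxx andbT /is_dimer_config.
  by rewrite (subset_trans (subD1set _ _) De) (trivIsetS _ tD) ?subD1set.
move=> [D']; rewrite inE => /andP[/andP[De tD] /eqP cD] ->.
have eND : e \notin D' by rewrite notin // cD.
rewrite setU11 andbT /is_dimer_config.
rewrite subUset De andbT sub1set inE e2 eqxx /=.
have ct : cover (e |: D') = e :|: cover D'.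
  by rewrite /cover bigcup_setU big_set1.
rewrite ct cD.
have -> : (e :|: S :\: e == S).
  apply/eqP/setP => z; rewrite !inE.
  case: eqP => [->|_] /=; first by rewrite xS.
  by case: eqP => [->|_] /=; first by rewrite yS.
have s0 : set0 \notin D'.
  by apply/negP => /(subsetP De); rewrite inE cards0.
rewrite andbT; suff h : {in D', forall B : {set _}, [disjoint e & B]}.
  by case: (trivIsetU1 h tD s0).
move=> B BD.
have BS : B \subset S :\: e by rewrite -cD; apply: bigcup_sup BD.
rewrite disjoint_sym; apply: disjointWl BS _.
by rewrite -setI_eq0 setDE -setIA [~: e :&: e]setIC setICr setI0.
Qed.

(** Induction on the size of S: a fixed vertex x of S has exactly one partner y
    in each perfect matching, and there are #|S| - 1 choices of y. *)
Lemma card_perfect_matchings n (S : {set 'I_n}) :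
  #|perfect_matchings S| = num_perfect_matchings #|S|.
Proof.
have [k] := ubnP #|S|; elim: k S => // k IH S; rewrite ltnS => Sk.
have [->|[x xS]] := set_0Vmem S.
  by rewrite perfect_matchings0 cards0 cards1.
have cardS : #|S| = #|S :\ x|.+1 by rewrite (cardsD1 x S) xS.
have part D : D \in perfect_matchings S ->
    exists2 y, y \in S :\ x & [set x; y] \in D.
  rewrite inE => /andP[/andP[/subsetP De _] /eqP cD].
  have /bigcupP[e eD xe] : x \in cover D by rewrite cD.
  have := De _ eD; rewrite inE => /cards2P[a [b [ab eab]]].
  have sub : e \subset S by rewrite -cD; apply: bigcup_sup eD.
  move: xe; rewrite eab !inE => /orP[|]/eqP xE.
    exists b; last by rewrite xE -eab.
    by rewrite !inE xE eq_sym ab (subsetP sub) // eab !inE eqxx orbT.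
  exists a; last by rewrite xE setUC -eab.
  by rewrite !inE xE ab (subsetP sub) // eab !inE eqxx.
have uniqp D y z : D \in perfect_matchings S -> y \in S :\ x -> z \in S :\ x ->
    [set x; y] \in D -> [set x; z] \in D -> y = z.
  rewrite inE => /andP[/andP[_ tD] _] yS zS yD zD.
  have : [set x; y] = [set x; z].
    apply/eqP; apply: contraT => neq.
    have := trivIsetP tD _ _ yD zD neq.
    by rewrite -setI_eq0 => /eqP /setP /(_ x); rewrite !inE eqxx.
  move=> /setP /(_ y); rewrite !inE eqxx orbT => /esym /orP[|] /eqP // yx.
  by move: yS; rewrite yx !inE eqxx.
have -> : #|perfect_matchings S| =
    \sum_(y in S :\ x) #|[set D in perfect_matchings S | [set x; y] \in D]|.
  rewrite -sum1_card.
  under [RHS]eq_bigr do rewrite -sum1_card.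
  under [RHS]eq_bigr do under eq_bigl do rewrite inE.
  rewrite (exchange_big_dep (fun D => D \in perfect_matchings S)) /=; last first.
    by move=> y D _ /andP[].
  apply: eq_bigr => D DS.
  have [y yS yD] := part D DS.
  rewrite (big_pred1 y) // => z /=; rewrite DS /=; apply/idP/eqP.
    by move=> /andP[zS zD]; apply: uniqp DS zS yS zD yD.
  by move=> ->; rewrite yS.
have card2 y : y \in S :\ x -> #|S :\: [set x; y]| = #|S :\ x|.-1.
  move=> yS; rewrite (_ : S :\: [set x; y] = (S :\ x) :\ y); last by rewrite setDDl.
  by rewrite (cardsD1 y (S :\ x)) yS.
rewrite (eq_bigr (fun=> num_perfect_matchings #|S :\ x|.-1)); last first.
  move=> y yS; rewrite card_perfect_matchings_edge // IH card2 //.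
  by apply: leq_ltn_trans (leq_pred _) _; rewrite -cardS.
rewrite sum_nat_const cardS; case: #|S :\ x| => [|m]; first by rewrite mul0n.
by rewrite num_perfect_matchingsSS.
Qed.

Lemma num_dimer_configsE n (s : config n) :
  num_dimer_configs s = num_perfect_matchings (n - #|monomer_support s|).
Proof.
rewrite (_ : n - _ = #|~: monomer_support s|); last by rewrite [RHS]cardsCs setCK card_ord.
rewrite -card_perfect_matchings /num_dimer_configs /monomers.
by apply: eq_card => D; rewrite !inE (can2_eq setCK setCK).
Qed.

End DimerCounting.

(** * The law of the number of monomers *)

Local Open Scope classical_set_scope.
Local Open Scope ring_scope.
Import DimerCounting.

Section MonomerNumber.
Variable R : realType.
Implicit Types (J h : R) (n k : nat).

(** Total Boltzmann weight of the configurations with exactly k monomers. It is 0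
    when k > n, through the binomial coefficient, and when n - k is odd. *)
Definition monomer_weight J h n k : R :=
  ('C(n, k) * num_perfect_matchings (n - k))%:R *
  expR (n%:R * (J * (k%:R / n%:R) ^+ 2
                + (ln n%:R / 2 + h - J) * (k%:R / n%:R))).

Lemma magnetizationE n (s : config n) :
  magnetization R s = #|monomer_support s|%:R / n%:R.
Proof.
congr (_ / _); rewrite -sum1_card natr_sum [RHS]big_mkcond /=.
by apply: eq_bigr => i _; rewrite inE; case: (s i).
Qed.

Lemma boltzmann_weightE n J h (s : config n) :
  boltzmann_weight J h s =
  (num_perfect_matchings (n - #|monomer_support s|))%:R *
  expR (n%:R * (J * (#|monomer_support s|%:R / n%:R) ^+ 2
     + (ln n%:R / 2 + h - J) * (#|monomer_support s|%:R / n%:R))).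
Proof.
by rewrite /boltzmann_weight num_dimer_configsE /neg_hamiltonian magnetizationE.
Qed.

Lemma sum_monomer_support n (E : pred nat) (F : nat -> R) :
  \sum_(s : config n | E #|monomer_support s|) F #|monomer_support s| =
  \sum_(k < n.+1 | E k) 'C(n, k)%:R * F k.
Proof.
have bij : {on (fun A : {set 'I_n} => E #|A|),
    bijective (fun s : config n => monomer_support s)}.
  exists (fun A : {set 'I_n} => [ffun i => i \in A]) => [s _|A _].
    by apply/ffunP => i; rewrite ffunE inE.
  by apply/setP => i; rewrite inE ffunE.
rewrite -(reindex _ bij (P := fun A : {set 'I_n} => E #|A|)
  (F := fun A : {set 'I_n} => F #|A|)) /=.
rewrite (partition_big (fun A : {set 'I_n} => inord #|A| : 'I_n.+1)
   (fun k : 'I_n.+1 => E k)) /=; last first.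
  move=> A EA; rewrite inordK // ltnS; have := max_card (mem A).
  by rewrite card_ord.
apply: eq_bigr => k Ek.
rewrite -[n in 'C(n, _)]card_ord -card_draws -sum1_card natr_sum mulr_suml.
apply: eq_big => [A|A /andP[_ /eqP <-]].
  rewrite inE -val_eqE /= inordK; last first.
    by rewrite ltnS; have := max_card (mem A); rewrite card_ord.
  by case: eqP => [->|]; rewrite ?Ek ?andbT ?andbF.
rewrite mul1r inordK // ltnS; have := max_card (mem A).
by rewrite card_ord.
Qed.

(** Gibbs probability of an event that depends only on the number of monomers. *)
Lemma gibbs_probE n J h (E : pred nat) :
  gibbs_prob J h [pred s : config n | E #|monomer_support s|] =
  (\sum_(k < n.+1 | E k) monomer_weight J h n k) /
  (\sum_(k < n.+1) monomer_weight J h n k).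
Proof.
pose F k : R := (num_perfect_matchings (n - k))%:R *
  expR (n%:R * (J * (k%:R / n%:R) ^+ 2
                + (ln n%:R / 2 + h - J) * (k%:R / n%:R))).
have wE k : monomer_weight J h n k = 'C(n, k)%:R * F k.
  by rewrite /monomer_weight natrM -mulrA.
have bE (s : config n) : boltzmann_weight J h s = F #|monomer_support s|.
  exact: boltzmann_weightE.
rewrite /gibbs_prob /gibbs -mulr_suml; congr (_ / _).
  rewrite (eq_bigr _ (fun s _ => bE s)) (sum_monomer_support n E F).
  by apply: eq_bigr => k _; rewrite wE.
rewrite (eq_bigr _ (fun s _ => bE s)) (sum_monomer_support n xpredT F).
by apply: eq_bigr => k _; rewrite wE.
Qed.

Lemma monomer_weight_ge0 J h n k : 0 <= monomer_weight J h n k.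
Proof. by rewrite mulr_ge0 ?expR_ge0. Qed.

Lemma monomer_weight_gt n J h k : (n < k)%N -> monomer_weight J h n k = 0.
Proof. by move=> nk; rewrite /monomer_weight bin_small // mul0n mul0r. Qed.

Lemma monomer_weight_odd n J h k : odd (n - k) -> monomer_weight J h n k = 0.
Proof.
by move=> nk; rewrite /monomer_weight num_perfect_matchings_odd // muln0 mul0r.
Qed.

Lemma monomer_weight_gt0 n J h k : (k <= n)%N -> ~~ odd (n - k) ->
  0 < monomer_weight J h n k.
Proof.
move=> kn nk; rewrite mulr_gt0 ?expR_gt0 // ltr0n muln_gt0.
by rewrite bin_gt0 kn num_perfect_matchings_gt0.
Qed.

(** The double factorials cancel in the ratio of two consecutive weights, and
    the term (ln n) / 2 of the external field contributes a factor n. The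
    identity also holds in the degenerate cases, where both sides vanish. *)
Lemma monomer_weightSS n J h k : (0 < n)%N ->
  monomer_weight J h n k.+2 =
  monomer_weight J h n k *
   ((n%:R * (n%:R - k%:R) / (k.+1%:R * k.+2%:R)) *
   expR (4 * J * (k.+1%:R / n%:R) + 2 * (h - J))).
Proof.
move=> n0; have nn : n%:R != 0 :> R by rewrite pnatr_eq0 -lt0n.
have [kn|kn] := leqP k n; last first.
  by rewrite (monomer_weight_gt _ _ kn) mul0r monomer_weight_gt // !ltnS ltnW // ltnW.
have [on|on] := boolP (odd (n - k)).
  rewrite (monomer_weight_odd _ _ on) mul0r.
  have [k2|k2] := leqP k.+2 n; last by rewrite monomer_weight_gt.
  rewrite monomer_weight_odd //; move: on.
  by rewrite (_ : (n - k = (n - k.+2).+2)%N) /= ?negbK //; lia.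
have [->|kn'] := eqVneq k n.
  by rewrite monomer_weight_gt ?subrr ?(mulr0, mul0r) //; lia.
have k2 : (k.+2 <= n)%N.
  have: (n - k != 1)%N by apply: contraNneq on => ->.
  lia.
have comb : ('C(n, k.+2) * num_perfect_matchings (n - k.+2))%:R
   = ('C(n, k) * num_perfect_matchings (n - k))%:R *
     ((n%:R - k%:R) / (k.+1%:R * k.+2%:R)) :> R.
  apply: (mulIf (x := k.+1%:R * k.+2%:R)); first by rewrite mulf_neq0 ?pnatr_eq0.
  rewrite -mulrA divfK ?mulf_neq0 ?pnatr_eq0 // -natrB // -!natrM; congr (_%:R).
  have e : (n - k = (n - k.+2).+2)%N by lia.
  have h1 := mul_bin_left n k; have h2 := mul_bin_left n k.+1.
  rewrite e num_perfect_matchingsSS in h1 *.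
  rewrite (_ : n - k.+1 = (n - k.+2).+1)%N in h2; last lia.
  move: h1 h2; set C2 := 'C(_, k.+2); set C1 := 'C(_, k.+1); set C0 := 'C(_, k).
  set m := (n - k.+2)%N; set M := num_perfect_matchings m => h1 h2.
  transitivity ((k.+2 * C2) * (k.+1 * M))%N; first by lia.
  transitivity ((k.+1 * C1) * (m.+1 * M))%N; first by rewrite h2; lia.
  by rewrite h1; lia.
rewrite /monomer_weight comb.
rewrite (_ : n%:R * (J * (k.+2%:R / n%:R) ^+ 2
            + (ln n%:R / 2 + h - J) * (k.+2%:R / n%:R))
  = n%:R * (J * (k%:R / n%:R) ^+ 2
            + (ln n%:R / 2 + h - J) * (k%:R / n%:R)) +
    (4 * J * (k.+1%:R / n%:R) + 2 * (h - J)) + ln n%:R); last first.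
  by rewrite -(natr1 k) -(natr1 k.+1) -(natr1 k); field.
rewrite !expRD lnK ?posrE ?ltr0n //.
set A := expR _; set B := expR _; ring.
Qed.

End MonomerNumber.

(** * The critical parameters and the quartic coefficient *)

Section PointwiseDerivatives.
Variable R : realType.
Implicit Types (f g : R -> R) (x a b c : R).

(** Differentiation rules der_add to der_inv for functions written pointwise, with
    products rather than scalings in the derivatives. *)
Lemma der_add f g x a b : is_derive x 1 f a -> is_derive x 1 g b ->
  is_derive x 1 (fun y => f y + g y) (a + b).
Proof. by move=> df dg; apply: is_deriveD. Qed.

Lemma der_sub f g x a b : is_derive x 1 f a -> is_derive x 1 g b ->
  is_derive x 1 (fun y => f y - g y) (a - b).
Proof. by move=> df dg; apply: is_deriveB. Qed.

Lemma der_mul f g x a b : is_derive x 1 f a -> is_derive x 1 g b ->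
  is_derive x 1 (fun y => f y * g y) (a * g x + f x * b).
Proof.
move=> df dg; apply: is_derive_eq.
by rewrite /GRing.scale /= addrC [g x * a]mulrC.
Qed.

Lemma der_scale f x a c : is_derive x 1 f a ->
  is_derive x 1 (fun y => c * f y) (c * a).
Proof. by move=> df; apply: is_deriveZ. Qed.

Lemma der_cst c x : is_derive x 1 (fun=> c) 0.
Proof. exact: is_derive_cst. Qed.

Lemma der_id x : is_derive x 1 (fun y : R => y) 1.
Proof. exact: is_derive_id. Qed.

Lemma der_comp f g x a b : is_derive (g x) 1 f a -> is_derive x 1 g b ->
  is_derive x 1 (fun y => f (g y)) (a * b).
Proof. by move=> df dg; apply: is_derive1_comp. Qed.

Lemma der_inv f x a : f x != 0 -> is_derive x 1 f a ->
  is_derive x 1 (fun y => (f y)^-1) (- a / f x ^+ 2).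
Proof.
move=> fx df; apply: (is_derive_eq (is_deriveV fx df)).
by rewrite /GRing.scale /= mulNr mulrC mulNr.
Qed.

End PointwiseDerivatives.

Section QuarticCoefficient.
Variable R : realType.
Local Notation J := (@J_c R).
Local Notation h := (@h_c R).
Local Notation m := (@m_c R).
Local Notation r2 := (Num.sqrt 2 : R).

Lemma sqrt2_sqr : r2 ^+ 2 = 2.
Proof. by rewrite sqr_sqrtr. Qed.

Lemma sqrt2_bounds : 7 / 5 < r2 /\ r2 < 3 / 2.
Proof.
have hs := sqrt2_sqr; have h0 : 0 <= r2 by rewrite sqrtr_ge0.
by split; nra.
Qed.

Lemma J_cE : J = (3 + 2 * r2) / 4.
Proof.
have hs := sqrt2_sqr; have [h1 h2] := sqrt2_bounds.
rewrite /J_c; apply: (mulIf (x := 4 * (3 - 2 * r2))); first lra.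
rewrite divfK; nra.
Qed.

Lemma m_c_bounds : 1 / 2 < m /\ m < 3 / 5.
Proof. by have [h1 h2] := sqrt2_bounds; rewrite /m_c; split; lra. Qed.

(* The argument of the logarithm in h_c is the square of 2 (1 - m_c). *)
Lemma h_cE : h = ln (2 * (1 - m)) / 2 - 1 / 4.
Proof.
have hs := sqrt2_sqr; have [h1 h2] := sqrt2_bounds.
rewrite /h_c.
have -> : 12 - 8 * r2 = (2 * (1 - m)) ^+ 2 by rewrite /m_c; nra.
rewrite lnXn /m_c; lra.
Qed.

Lemma J_c_m_c : (2 * m - 1) * J = 1 / 4.
Proof. by have hs := sqrt2_sqr; rewrite J_cE /m_c; nra. Qed.

Lemma m_c_sqr : m ^+ 2 = 2 * (1 - m) ^+ 2.
Proof. by have hs := sqrt2_sqr; rewrite /m_c; nra. Qed.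

Lemma g_gt0 (x : R) : 0 < g x :> R.
Proof.
rewrite /g divr_gt0 // subr_gt0 -[ltLHS]ger0_norm ?expR_ge0 // -sqrtr_sqr.
rewrite ltr_sqrt; last by rewrite addr_gt0 ?mulr_gt0 ?expR_gt0.
have -> : expR (2 * x) ^+ 2 = expR (4 * x).
  by rewrite -expRM_natl; congr expR; ring.
by rewrite ltrDl mulr_gt0 ?expR_gt0.
Qed.

(** The defining quadratic equation of g: g^2 + e^(2x) g = e^(2x). *)
Lemma g_root (x : R) : g x ^+ 2 + expR (2 * x) * g x = expR (2 * x) :> R.
Proof.
rewrite /g.
have -> : expR (4 * x) = expR (2 * x) ^+ 2.
  by rewrite -expRM_natl; congr expR; ring.
set E := expR (2 * x); have E0 : 0 < E by rewrite expR_gt0.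
have sq : Num.sqrt (E ^+ 2 + 4 * E) ^+ 2 = E ^+ 2 + 4 * E.
  by rewrite sqr_sqrtr //; nra.
nra.
Qed.

Lemma g_lt1 (x : R) : g x < 1 :> R.
Proof.
have h1 := g_root x; have h2 := g_gt0 x; have h3 := expR_gt0 (2 * x).
rewrite ltNge; apply/negP => g1; nra.
Qed.

(** The derivative of the explicit formula for g, expressed through g alone. *)
Lemma der_g (x : R) : is_derive x 1 (@g R) (2 * g x * (1 - g x) / (2 - g x)).
Proof.
have E0 : 0 < expR (2 * x) by rewrite expR_gt0.
have e4 : expR (4 * x) = expR (2 * x) ^+ 2.
  by rewrite -expRM_natl; congr expR; ring.
have dE c : is_derive x 1 (fun y : R => expR (c * y)) (expR (c * x) * (c * 1)).
  exact: (der_comp (f := @expR R) (is_derive_expR _) (der_scale c (der_id x))).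
have A0 : 0 < expR (4 * x) + 4 * expR (2 * x) by rewrite e4; nra.
pose S := Num.sqrt (expR (4 * x) + 4 * expR (2 * x)).
have S0 : 0 < S by rewrite sqrtr_gt0.
have SE : S ^+ 2 = expR (2 * x) ^+ 2 + 4 * expR (2 * x).
  by rewrite /S sqr_sqrtr ?e4 //; rewrite -e4 ltW.
have gE : g x = (S - expR (2 * x)) / 2 by [].
have h1 := g_root x.
have := der_mul (der_sub (der_comp (f := @Num.sqrt R)
  (g := fun y : R => expR (4 * y) + 4 * expR (2 * y)) (is_derive1_sqrt A0)
  (der_add (dE 4) (der_scale 4 (dE 2)))) (dE 2)) (der_cst 2^-1 x).
move=> H; apply: (is_derive_eq H).
rewrite -/S mulr0 addr0 e4 gE.
set E := expR (2 * x) in E0 SE *.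
have SE' : S != 0 by rewrite gt_eqF.
have n2 : 2 - (S - E) / 2 != 0.
  rewrite gt_eqF //; nra.
apply: (mulIf n2); rewrite divfK //.
apply: (mulIf SE').
have -> : (((2 * S)^-1 * (E ^+ 2 * (4 * 1) + 4 * (E * (2 * 1))) - E * (2 * 1)) * 2^-1 *
   (2 - (S - E) / 2) * S) = ((E ^+ 2 + 2 * E) - E * S) * (2 - (S - E) / 2).
  by field.
nra.
Qed.

(** The composition of g with the affine map tau satisfies the autonomous
    equation G' = q(G) (der_G). *)
Let G (x : R) := g (tau J h x).
Let q (y : R) := 4 * J * (y * (1 - y) / (2 - y)).

Lemma der_tau (x : R) : is_derive x 1 (tau J h) (2 * J).
Proof.
have H := der_add (der_mul (der_sub (der_scale 2 (der_id x)) (der_cst 1 x))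
  (der_cst J x)) (der_cst h x).
by apply: (is_derive_eq H); ring.
Qed.

Lemma der_G (x : R) : is_derive x 1 G (q (G x)).
Proof.
have H := der_comp (f := @g R) (der_g (tau J h x)) (der_tau x).
by apply: (is_derive_eq H); rewrite /q -/(G x); ring.
Qed.

(** The last term of p_tilde at x is an antiderivative of g, read at tau x; hence the
    critical points of p_tilde are the solutions of the consistency equation
    g (tau x) = x. *)
Lemma der_p_tilde (x : R) : is_derive x 1 (p_tilde J h) (2 * J * (G x - x)).
Proof.
have G1 : 0 < 1 - G x by rewrite subr_gt0 g_lt1.
have d1 : is_derive x 1 (fun y => 1 - G y) (0 - q (G x)).
  exact: (der_sub (der_cst 1 x) (der_G x)).
have dln : is_derive x 1 (fun y => ln (1 - G y)) ((1 - G x)^-1 * (0 - q (G x))).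
  exact: (der_comp (f := @ln R) (g := fun y => 1 - G y) (is_derive1_ln G1) d1).
have dsq : is_derive x 1 (fun y : R => y ^+ 2) (1 * x + x * 1).
  exact: (der_mul (der_id x) (der_id x)).
have := der_sub (der_scale (- J) dsq) (der_mul (der_add d1 dln) (der_cst 2^-1 x)).
move=> H; apply: (is_derive_eq H).
have G2 : 2 - G x != 0 by rewrite gt_eqF //; lra.
by rewrite /q; field; rewrite G2 gt_eqF.
Qed.

(** The first two derivatives of q. *)
Let q1 (y : R) := 4 * J * (1 - 2 / (2 - y) ^+ 2).
Let q2 (y : R) := - 16 * J / (2 - y) ^+ 3.

Lemma der_q (y : R) : y < 1 -> is_derive y 1 q (q1 y).
Proof.
move=> y1; have y2 : 2 - y != 0 by rewrite gt_eqF //; lra.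
have H := der_scale (4 * J) (der_mul
  (der_mul (der_id y) (der_sub (der_cst 1 y) (der_id y)))
  (der_inv (f := fun z : R => 2 - z) y2 (der_sub (der_cst 2 y) (der_id y)))).
by apply: (is_derive_eq H); rewrite /q1; field.
Qed.

Lemma der_q1 (y : R) : y < 1 -> is_derive y 1 q1 (q2 y).
Proof.
move=> y1; have y2 : 2 - y != 0 by rewrite gt_eqF //; lra.
have d2 := der_sub (der_cst 2 y) (der_id y).
have H := der_scale (4 * J) (der_sub (der_cst 1 y)
  (der_scale 2 (der_inv (f := fun z : R => (2 - z) * (2 - z)) (mulf_neq0 y2 y2)
    (der_mul d2 d2)))).
by apply: (is_derive_eq H); rewrite /q2; field.
Qed.

Lemma derive1_of (f df : R -> R) : (forall x : R, is_derive x 1 f (df x)) ->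
  derive1 f = df.
Proof.
by move=> H; apply/funext => x; rewrite derive1E; apply: derive_val.
Qed.

(** The critical density m_c solves the consistency equation. *)
Lemma G_m_c : G m = m.
Proof.
rewrite /G /tau J_c_m_c h_cE.
have [a b] := m_c_bounds; have ms := m_c_sqr.
rewrite /g (_ : 4 * _ = 2 * ln (2 * (1 - m))); last by field.
rewrite (_ : 2 * (1 / 4 + _) = ln (2 * (1 - m))); last by field.
rewrite expRM_natl lnK ?posrE; last lra.
have -> : (2 * (1 - m)) ^+ 2 + 4 * (2 * (1 - m)) = 2 ^+ 2 :> R by nra.
by rewrite sqrtr_sqr ger0_norm //; field.
Qed.

(** Since G' = q(G), the fourth derivative of p_tilde is 2 J (q'' q^2 + q'^2 q) at
    G. At m_c one has q = 1 and q' = 0, so that only 2 J q'' survives. *)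
Lemma lambda_cE : @lambda_c R = 4 * J / (m * (1 - m)).
Proof.
rewrite /lambda_c !derive1nS derive1n0.
rewrite (derive1_of der_p_tilde).
have d1 (x : R) : is_derive x 1 (fun y => 2 * J * (G y - y)) (2 * J * (q (G x) - 1)).
  exact: (der_scale _ (der_sub (der_G x) (der_id x))).
rewrite (derive1_of d1).
have dqG (x : R) : is_derive x 1 (fun y => q (G y)) (q1 (G x) * q (G x)).
  exact: (der_comp (f := q) (g := G) (der_q (g_lt1 _)) (der_G x)).
have d2 (x : R) : is_derive x 1 (fun y => 2 * J * (q (G y) - 1))
    (2 * J * (q1 (G x) * q (G x) - 0)).
  exact: (der_scale _ (der_sub (dqG x) (der_cst 1 x))).
rewrite (derive1_of d2).
have d3 (x : R) : is_derive x 1 (fun y => 2 * J * (q1 (G y) * q (G y) - 0))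
  (2 * J * ((q2 (G x) * q (G x)) * q (G x) + q1 (G x) * (q1 (G x) * q (G x)) - 0)).
  apply: der_scale (der_sub (der_mul _ (dqG x)) (der_cst 0 x)).
  exact: (der_comp (f := q1) (g := G) (der_q1 (g_lt1 _)) (der_G x)).
rewrite (derive1_of d3) G_m_c.
have hs := sqrt2_sqr; have [h1 h2] := sqrt2_bounds.
have q1m : q1 m = 0.
  by rewrite /q1 /m_c (_ : 2 - (2 - r2) = r2) ?hs ?divff ?subrr ?mulr0 //; ring.
have qm : q m = 1.
  rewrite /q J_cE /m_c (_ : 2 - (2 - r2) = r2); last ring.
  apply: (mulIf (x := r2)); first by rewrite gt_eqF //; lra.
  rewrite mul1r -!mulrA mulVf ?mulr1; last by rewrite gt_eqF //; lra.
  nra.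
rewrite q1m qm mul0r addr0 subr0 !mulr1 /q2 J_cE /m_c (_ : 2 - (2 - r2) = r2); last ring.
have m0 : (2 - r2) * (1 - (2 - r2)) != 0.
  by rewrite mulf_neq0 // gt_eqF //; lra.
have r0 : r2 ^+ 3 != 0 by rewrite expf_neq0 // gt_eqF //; lra.
have r23 : r2 ^+ 3 = 2 * r2 by rewrite exprS hs mulrC.
have Asq : (3 + 2 * r2) ^+ 2 = 17 + 12 * r2 by nra.
transitivity (2 * (3 + 2 * r2) ^+ 2 / r2 ^+ 3); first by field; rewrite gt_eqF //; lra.
apply/eqP; rewrite eqr_div // r23 Asq; apply/eqP.
nra.
Qed.

End QuarticCoefficient.

(** * The drift of the weights near the critical density *)

Section Drift.
Variable R : realType.
Local Notation J := (@J_c R).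
Local Notation h := (@h_c R).
Local Notation m := (@m_c R).
Local Notation lam := (@lambda_c R).

(** Mean value theorem for a function differentiable on a closed interval,
    end points included. *)
Lemma MVT_closed (f df : R -> R) (a b : R) : a <= b ->
  (forall x, a <= x <= b -> is_derive x 1 f (df x)) ->
  exists2 c, a <= c <= b & f b - f a = df c * (b - a).
Proof.
move=> ab fd.
have [||c cab fE] := @MVT_segment R f df a b ab.
- by move=> x /[!in_itv] /= /andP[ax xb]; apply: fd; rewrite !ltW.
- apply: continuous_in_subspaceT => x; rewrite inE /= in_itv /= => xab.
  have fdx := fd x xab.
  by apply/differentiable_continuous/derivable1_diffP; apply: ex_derive.
by exists c => //; move: cab; rewrite in_itv.
Qed.

Lemma J_c_bounds : 1 < J /\ J < 3 / 2.
Proof. by have [h1 h2] := sqrt2_bounds R; rewrite J_cE; split; lra. Qed.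

(** Leading order of the logarithm of the ratio of the weights of k + 2 and k
    monomers, as a function of the density x = k / n. *)
Definition drift (x : R) : R :=
  ln (1 - x) - 2 * ln x + 4 * J * x + 2 * (h - J).

Lemma drift_m_c : drift m = 0.
Proof.
have [m1 m2] := m_c_bounds R; have ms := m_c_sqr R; have jm := J_c_m_c R.
have e1 : 2 * ln m = ln 2 + 2 * ln (1 - m).
  have : ln (m ^+ 2) = ln (2 * (1 - m) ^+ 2) by rewrite ms.
  have c0 : 0 < 1 - m by lra.
  rewrite (lnXn 2 (_ : 0 < m)); last lra.
  rewrite lnM ?posrE ?exprn_gt0 // (lnXn 2 c0).
  rewrite !mulr2n; lra.
have c0 : 0 < 1 - m by lra.
rewrite /drift e1 h_cE lnM ?posrE //; lra.
Qed.

(** At the critical parameters the numerator of the derivative of the drift is a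
    perfect square: m_c is a double zero of the derivative. *)
Lemma der_drift (x : R) : 0 < x < 1 ->
  is_derive x 1 drift (- (4 * J * (x - m) ^+ 2 / (x * (1 - x)))).
Proof.
move=> /andP[x0 x1].
have y0 : 0 < 1 - x by lra.
have H1 := der_comp (f := @ln R) (g := fun y : R => 1 - y) (is_derive1_ln y0)
  (der_sub (der_cst 1 x) (der_id x)).
have H := der_add (der_add (der_sub H1 (der_scale 2 (is_derive1_ln x0)))
  (der_scale (4 * J) (der_id x))) (der_cst (2 * (h - J)) x).
apply: (is_derive_eq H).
have xn : x != 0 by rewrite gt_eqF.
have yn : 1 - x != 0 by rewrite gt_eqF.
apply: (mulIf (mulf_neq0 xn yn)); rewrite mulNr divfK ?mulf_neq0 //.
have -> : ((1 - x)^-1 * (0 - 1) - 2 * x^-1 + 4 * J * 1 + 0) * (x * (1 - x))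
  = - x - 2 * (1 - x) + 4 * J * (x * (1 - x)) by field; rewrite xn.
have hs := sqrt2_sqr R.
have e1 : 4 * J * m = 2 + Num.sqrt 2 by rewrite J_cE /m_c; nra.
have e2 : 4 * J * m * m = 2 by rewrite e1 /m_c; nra.
rewrite (_ : - (4 * J * (x - m) ^+ 2) =
  - (4 * J) * x ^+ 2 + 2 * (4 * J * m) * x - 4 * J * m * m); last by ring.
by rewrite e2 e1 J_cE; field.
Qed.

Lemma drift_slope_ge0 (x : R) : 0 < x -> x < 1 ->
  0 <= 4 * J * (x - m) ^+ 2 / (x * (1 - x)).
Proof.
move=> x0 x1; have [j1 j2] := J_c_bounds.
apply: divr_ge0; last by apply: mulr_ge0; lra.
by apply: mulr_ge0; [lra|rewrite sqr_ge0].
Qed.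

Lemma drift_ge0 (x : R) : 0 < x -> x <= m -> 0 <= drift x.
Proof.
move=> x0 xm; have [m1 m2] := m_c_bounds R; have [j1 j2] := J_c_bounds.
have [c /andP[xc cm] E] := MVT_closed (f := drift) xm
  (fun y hy => der_drift (x := y) ltac:(move/andP: hy => [? ?]; apply/andP; split; lra)).
have : 0 <= 4 * J * (c - m) ^+ 2 / (c * (1 - c)).
  by apply: drift_slope_ge0; lra.
move: E; rewrite drift_m_c; nra.
Qed.

Lemma drift_le0 (x : R) : x < 1 -> m <= x -> drift x <= 0.
Proof.
move=> x1 mx; have [m1 m2] := m_c_bounds R; have [j1 j2] := J_c_bounds.
have [c /andP[xc cm] E] := MVT_closed (f := drift) mx
  (fun y hy => der_drift (x := y) ltac:(move/andP: hy => [? ?]; apply/andP; split; lra)).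
have : 0 <= 4 * J * (c - m) ^+ 2 / (c * (1 - c)).
  by apply: drift_slope_ge0; lra.
move: E; rewrite drift_m_c; nra.
Qed.

Lemma lambda_c_gt0 : 0 < lam.
Proof.
have [m1 m2] := m_c_bounds R; have [j1 j2] := J_c_bounds.
by rewrite lambda_cE; apply: divr_gt0; [|apply: mulr_gt0]; lra.
Qed.

Lemma drift_cubic_der (t : R) : `|t| <= 1 / 10 ->
  `|lam * t ^+ 2 - 4 * J * t ^+ 2 / ((m + t) * (1 - (m + t)))| <= 36 * `|t| ^+ 3.
Proof.
move=> t1; have [m1 m2] := m_c_bounds R; have [j1 j2] := J_c_bounds.
have : - (1 / 10) <= t <= 1 / 10 by rewrite -ler_norml.
move=> /andP[ta tb].
have a0 : 0 < m * (1 - m) by apply: mulr_gt0; lra.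
have b0 : 0 < (m + t) * (1 - (m + t)) by apply: mulr_gt0; lra.
have a1 : 6 / 25 <= m * (1 - m) by nra.
have b1 : 21 / 100 <= (m + t) * (1 - (m + t)) by nra.
rewrite lambda_cE.
have -> : 4 * J / (m * (1 - m)) * t ^+ 2
   - 4 * J * t ^+ 2 / ((m + t) * (1 - (m + t)))
   = 4 * J * t ^+ 3 * (1 - 2 * m - t) / ((m * (1 - m)) * ((m + t) * (1 - (m + t)))).
  field; rewrite !gt_eqF //; lra.
rewrite normrM normfV (normrM (4 * J * t ^+ 3)) (normrM (4 * J)) normrX.
rewrite (gtr0_norm (x := 4 * J)); last lra.
have ab0 := mulr_gt0 a0 b0.
rewrite (gtr0_norm ab0) ler_pdivrMr //.
have d1 : 1 / 20 <= m * (1 - m) * ((m + t) * (1 - (m + t))) by nra.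
have d2 : `|1 - 2 * m - t| <= 3 / 10 by rewrite ler_norml; apply/andP; split; lra.
have t3 : 0 <= `|t| ^+ 3 by rewrite exprn_ge0.
apply: (@le_trans _ _ (`|t| ^+ 3 * (9 / 5))).
  rewrite (_ : 4 * J * `|t| ^+ 3 * `|1 - 2 * m - t| =
     `|t| ^+ 3 * (4 * J * `|1 - 2 * m - t|)); last by ring.
  by apply: ler_wpM2l => //; have := normr_ge0 (1 - 2 * m - t); nra.
nra.
Qed.

(** Cubic expansion of the drift at m_c, with explicit constants, obtained from
    drift_cubic_der by the mean value theorem. *)
Lemma drift_cubic (t : R) : `|t| <= 1 / 10 ->
  `|drift (m + t) + lam / 3 * t ^+ 3| <= 36 * t ^+ 4.
Proof.
move=> t1; have [m1 m2] := m_c_bounds R.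
pose F (y : R) := drift (m + y) + lam / 3 * y ^+ 3.
pose dF (y : R) := lam * y ^+ 2
  - 4 * J * y ^+ 2 / ((m + y) * (1 - (m + y))).
have tt : - (1 / 10) <= t <= 1 / 10 by rewrite -ler_norml.
have Fd (y : R) : - (1 / 10) <= y <= 1 / 10 -> is_derive y 1 F (dF y).
  move=> /andP[y1 y2].
  have h01 : 0 < m + y < 1 by apply/andP; split; lra.
  have H1 := der_comp (f := drift) (g := fun z : R => m + z) (der_drift h01)
    (der_add (der_cst m y) (der_id y)).
  have H2 := der_mul (der_mul (der_id y) (der_id y)) (der_id y).
  have := der_add H1 (der_scale (lam / 3) H2).
  rewrite (_ : (fun z : R => _ + lam / 3 * (z * z * z)) = F); last first.
    by apply/funext => z; rewrite /F; congr (_ + _ * _); ring.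
  move=> H; apply: (is_derive_eq H); rewrite /dF (_ : m + y - m = y); last by ring.
  by field; rewrite !gt_eqF //; lra.
have F0 : F 0 = 0 by rewrite /F addr0 drift_m_c expr0n /= mulr0 addr0.
have [c ct E] : exists2 c, `|c| <= `|t| & F t = dF c * t.
  have [t0|t0] := leP 0 t.
    have [|c /andP[c1 c2] E] := MVT_closed (f := F) (df := dF) t0.
      by move=> y /andP[y1 y2]; apply: Fd; apply/andP; split; lra.
    exists c; first by rewrite !ger0_norm //; lra.
    by move: E; rewrite F0 !subr0.
  have [|c /andP[c1 c2] E] := MVT_closed (f := F) (df := dF) (ltW t0).
    by move=> y /andP[y1 y2]; apply: Fd; apply/andP; split; lra.
  exists c; first by rewrite !ler0_norm //; lra.
  by move: E; rewrite F0; lra.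
rewrite -/(F t) E normrM.
have := drift_cubic_der (le_trans ct t1); rewrite -/(dF c) => Hc.
have -> : t ^+ 4 = `|t| ^+ 3 * `|t|.
  by rewrite -exprSr -normrX ger0_norm // exprn_even_ge0.
rewrite mulrA; apply: ler_wpM2r => //.
apply: le_trans Hc _; rewrite ler_wpM2l //.
by rewrite lerXn2r ?nnegrE.
Qed.

(** The ratio of the weights of k + 2 and k monomers (see monomer_weightSS). *)
Definition weight_ratio (n k : nat) : R :=
  (n%:R * (n%:R - k%:R) / (k.+1%:R * k.+2%:R)) *
   expR (4 * J * (k.+1%:R / n%:R) + 2 * (h - J)).

(** The exponential of the drift in the rational form taken by weight_ratio. *)
Lemma expR_drift (x y : R) : 0 < x < 1 ->
  expR (drift x + y) = (1 - x) / x ^+ 2 * expR (4 * J * x + 2 * (h - J) + y).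
Proof.
move=> /andP[x0 x1].
rewrite /drift -!addrA !expRD lnK ?posrE; last lra.
by rewrite expRN expRM_natl lnK ?posrE // !mulrA.
Qed.

(** Below m_c the weights are nondecreasing in k up to factors 1 - O(1/n); these
    remain bounded when multiplied over the at most n steps of the chain. *)
Lemma weight_ratio_ge (n k : nat) : (0 < n)%N -> k.+2%:R / n%:R <= m ->
  expR (- (6 / n%:R)) <= weight_ratio n k.
Proof.
move=> n0 km; have [m1 m2] := m_c_bounds R; have [j1 j2] := J_c_bounds.
have n0' : 0 < n%:R :> R by rewrite ltr0n.
set x := _ / _ in km; have x0 : 0 < x by rewrite divr_gt0 // ltr0n.
have x1 : 0 < x < 1 by apply/andP; split; lra.
apply: (@le_trans _ _ (expR (drift x + - (4 * J / n%:R)))).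
  rewrite ler_expR; have := drift_ge0 x0 km.
  have : 4 * J / n%:R <= 6 / n%:R by rewrite ler_pM2r ?invr_gt0 //; lra.
  lra.
have kE : k.+2%:R = x * n%:R by rewrite /x divfK ?gt_eqF.
have k1E : k.+1%:R = x * n%:R - 1 by rewrite -kE -[k.+2%:R]natr1; ring.
have kk : k%:R = x * n%:R - 2 by rewrite -kE -[k.+2%:R]natr1 -natr1; ring.
have k10 : 0 < k.+1%:R :> R by rewrite ltr0n.
have k20 : 0 < k.+2%:R :> R by rewrite ltr0n.
rewrite expR_drift // /weight_ratio.
rewrite (_ : 4 * J * x + _ + _ = 4 * J * (k.+1%:R / n%:R) + 2 * (h - J)); last first.
  by rewrite k1E; field; rewrite gt_eqF.
rewrite ler_wpM2r ?expR_ge0 //.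
rewrite ler_pdivlMr ?mulr_gt0 // mulrAC ler_pdivrMr ?exprn_gt0 //.
rewrite kE k1E kk in k10 k20 *.
have y0 : 0 < 1 - x by lra.
have : (1 - x) * ((x * n%:R - 1) * (x * n%:R)) <= (1 - x) * ((x * n%:R) * (x * n%:R)).
  by rewrite ler_wpM2l ?(ltW y0) // ler_wpM2r ?(ltW k20) //; lra.
have : 0 <= n%:R * x ^+ 2 * 2 by rewrite !mulr_ge0 ?sqr_ge0 // ltW.
nra.
Qed.

(** Above m_c the weights are nonincreasing in k up to factors 1 + O(1/n). *)
Lemma weight_ratio_le (n k : nat) : (0 < n)%N -> m <= k%:R / n%:R -> (k <= n)%N ->
  weight_ratio n k <= expR (6 / n%:R).
Proof.
move=> n0 km kn; have [m1 m2] := m_c_bounds R; have [j1 j2] := J_c_bounds.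
have n0' : 0 < n%:R :> R by rewrite ltr0n.
have [->|kn'] := eqVneq k n.
  by rewrite /weight_ratio subrr !(mulr0, mul0r) expR_ge0.
have kln : k%:R < n%:R :> R by rewrite ltr_nat ltn_neqAle kn' kn.
set x := _ / _ in km; have x0 : 0 < x by lra.
have x1 : x < 1 by rewrite ltr_pdivrMr // mul1r.
have x01 : 0 < x < 1 by rewrite x0 x1.
apply: (@le_trans _ _ (expR (drift x + 4 * J / n%:R))); last first.
  rewrite ler_expR; have := drift_le0 x1 km.
  have : 4 * J / n%:R <= 6 / n%:R by rewrite ler_pM2r ?invr_gt0 //; lra.
  lra.
have kE : k%:R = x * n%:R by rewrite /x divfK ?gt_eqF.
have k1E : k.+1%:R = x * n%:R + 1 by rewrite -natr1 kE.
have k2E : k.+2%:R = x * n%:R + 1 + 1 by rewrite -natr1 k1E.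
rewrite expR_drift // /weight_ratio k1E k2E kE.
rewrite (_ : 4 * J * x + _ + _ = 4 * J * ((x * n%:R + 1) / n%:R) + 2 * (h - J)); last first.
  by field; rewrite gt_eqF.
rewrite ler_wpM2r ?expR_ge0 //.
have xn0 : 0 < x * n%:R by rewrite mulr_gt0.
rewrite ler_pdivrMr ?mulr_gt0 //; [|lra|lra].
rewrite [leRHS]mulrAC ler_pdivlMr ?exprn_gt0 //.
have y0 : 0 < 1 - x by lra.
have : (1 - x) * ((x * n%:R) * (x * n%:R)) <= (1 - x) * ((x * n%:R + 1) * (x * n%:R + 1 + 1)).
  by rewrite ler_wpM2l ?(ltW y0) // ler_pM //; lra.
nra.
Qed.

Lemma weight_ratio_near (n k : nat) : (0 < n)%N -> `|k%:R / n%:R - m| <= 1 / 10 ->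
  exists2 e, `|e| <= 8 / n%:R & weight_ratio n k = expR (drift (k%:R / n%:R) + e).
Proof.
move=> n0 km; have [m1 m2] := m_c_bounds R; have [j1 j2] := J_c_bounds.
have n0' : 0 < n%:R :> R by rewrite ltr0n.
set x := _ / _ in km *.
move: km; rewrite ler_norml => /andP[xa xb].
have x01 : 0 < x < 1 by apply/andP; split; lra.
have x0 : 0 < x by lra.
have kE : k%:R = x * n%:R by rewrite /x divfK ?gt_eqF.
have k0 : 0 < k%:R :> R by rewrite kE mulr_gt0.
pose u : R := (1 + k%:R^-1) * (1 + 2 / k%:R).
have ki : 0 < k%:R^-1 :> R by rewrite invr_gt0.
have u0 : 0 < u by rewrite mulr_gt0 // ?addr_gt0 ?mulr_gt0.
exists (4 * J / n%:R - ln u); last first.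
  rewrite expR_drift // !expRD expRN lnK ?posrE // /weight_ratio expRD.
  have k1E : k.+1%:R = k%:R + 1 :> R by rewrite -natr1.
  have k2E : k.+2%:R = k%:R + 1 + 1 :> R by rewrite -natr1 k1E.
  rewrite k1E k2E.
  rewrite (_ : 4 * J * ((k%:R + 1) / n%:R) = 4 * J * x + 4 * J / n%:R); last first.
    by rewrite kE; field; rewrite gt_eqF.
  rewrite expRD.
  set A := expR _; set B := expR _; set C := expR _.
  rewrite /u kE; field.
  by rewrite !gt_eqF // -?kE //; lra.
have lu0 : 0 <= ln u by apply: ln_ge0; rewrite /u; nra.
have lu : ln u <= 15 / 2 / n%:R.
  have d2 : 0 < 1 + 2 / k%:R :> R by rewrite addr_gt0 ?mulr_gt0.
  have d1 : 0 < 1 + k%:R^-1 :> R by rewrite addr_gt0.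
  rewrite /u lnM ?posrE //.
  have l1 : ln (1 + k%:R^-1) <= k%:R^-1 :> R by apply: le_ln1Dx; lra.
  have l2 : ln (1 + 2 / k%:R) <= 2 / k%:R :> R by apply: le_ln1Dx; lra.
  have : k%:R^-1 <= (5 / 2) / n%:R :> R.
    rewrite -[k%:R^-1]mul1r ler_pdivrMr // mulrAC ler_pdivlMr // kE; nra.
  lra.
have : 4 * J / n%:R <= 6 / n%:R by rewrite ler_pM2r ?invr_gt0 //; lra.
have : 0 <= 4 * J / n%:R by rewrite divr_ge0 ?(ltW n0') //; lra.
have : 0 <= n%:R^-1 :> R by rewrite invr_ge0 ltW.
rewrite ler_norml => *; apply/andP; split; lra.
Qed.

(** Crude bound for the step that crosses m_c, where weight_ratio_ge does not
    apply. *)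
Lemma weight_ratio_lower : exists2 c : R, 0 < c &
  forall n k : nat, (k.+2 <= n)%N -> k%:R / n%:R < m -> c <= weight_ratio n k.
Proof.
have [m1 m2] := m_c_bounds R; have [j1 j2] := J_c_bounds.
exists (2 / 5 * expR (2 * (h - J))); first by rewrite mulr_gt0 ?expR_gt0.
move=> n k kn km; rewrite /weight_ratio.
have n0' : 0 < n%:R :> R by rewrite ltr0n; lia.
have k10 : 0 < k.+1%:R :> R by rewrite ltr0n.
have k20 : 0 < k.+2%:R :> R by rewrite ltr0n.
have k2n : k.+2%:R <= n%:R :> R by rewrite ler_nat.
have k1n : k.+1%:R <= n%:R :> R by rewrite ler_nat ltnW.
rewrite ltr_pdivrMr // in km.
apply: ler_pM => //; rewrite ?expR_ge0 //.
  rewrite ler_pdivlMr ?mulr_gt0 //.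
  apply: (@le_trans _ _ (2 / 5 * (n%:R * n%:R))); last by nra.
  by rewrite ler_wpM2l // ler_pM // ltW.
rewrite ler_expR lerDr; apply: mulr_ge0; first lra.
by rewrite divr_ge0 ?ltW.
Qed.

End Drift.

(** * Comparing a sequence with the quartic density along a half-line *)

Section OneSided.
Variable R : realType.
Implicit Types (s x w : R).

(** The j-th point of the grid of mesh 2 s^3. With s = n^(-1/4) the mesh is
    2 n^(-3/4), the spacing of the rescaled magnetization. *)
Definition grid s (j : nat) : R := j%:R * (2 * s ^+ 3).

(** The unnormalised quartic density with coefficient lam. *)
Definition quartic_exp (lam x : R) : R := expR (- lam * x ^+ 4 / 24).

(** The bound exp (- (2 w^2 + w)) used for all errors: the linear term makes it
    summable along the grid, and the quadratic one leaves exp (- 2 w^2) after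
    summation. *)
Definition envelope w : R := expR (- (2 * w ^+ 2 + w)).

Lemma gridS s j : grid s j.+1 = grid s j + 2 * s ^+ 3.
Proof. by rewrite /grid -natr1 mulrDl mul1r. Qed.

Lemma grid_ge0 s j : 0 <= s -> 0 <= grid s j.
Proof. by move=> s0; rewrite /grid !mulr_ge0 ?exprn_ge0. Qed.

Lemma grid_le s i j : 0 <= s -> (i <= j)%N -> grid s i <= grid s j.
Proof. by move=> s0 ij; rewrite /grid ler_wpM2r ?mulr_ge0 ?exprn_ge0 ?ler_nat. Qed.

Lemma le_expR x : x <= expR x.
Proof. by apply: le_trans (expR_ge1Dx x); lra. Qed.

Lemma expr3_le_expR x : 0 <= x -> x ^+ 3 <= 6 * expR x.
Proof. by move=> /(expR_ge1Dxn 2); rewrite /= !factS fact0; lra. Qed.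

Lemma expr5_le_expR x : 0 <= x -> x ^+ 5 <= 120 * expR x.
Proof. by move=> /(expR_ge1Dxn 4); rewrite /= !factS fact0; lra. Qed.

Lemma expR_sub1_le x : `|expR x - 1| <= `|x| * expR `|x|.
Proof.
have [x0|x0] := leP 0 x.
  rewrite !ger0_norm //; last by rewrite subr_ge0 -expR0 ler_expR.
  have := expR_ge1Dx (- x); rewrite expRN => h.
  have e0 := expR_gt0 x.
  have : (1 + - x) * expR x <= 1 by rewrite -ler_pdivlMr // mul1r.
  lra.
rewrite ltr0_norm; last by rewrite subr_lt0 -expR0 ltr_expR.
rewrite ltr0_norm // opprB.
have := expR_ge1Dx x => h.
have : 1 <= expR (- x) by rewrite -expR0 ler_expR; lra.
nra.
Qed.

(** A quartic exponential absorbs every exponential of a quadratic polynomial. *)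
Lemma quartic_absorb (a b d : R) : 0 < d -> exists2 C, 0 < C &
  forall w, 0 <= w -> expR (a * w + b * w ^+ 2 - d * w ^+ 4) <= C.
Proof.
move=> d0; pose c := `|a| + `|b|.
exists (expR (`|a| + c ^+ 2 / (4 * d))); first by rewrite expR_gt0.
move=> w w0; rewrite ler_expR.
have a1 : a * w <= `|a| * (1 + w ^+ 2).
  apply: (@le_trans _ _ (`|a| * w)); first by rewrite ler_wpM2r ?ler_norm.
  by rewrite ler_wpM2l //; nra.
have b1 : b * w ^+ 2 <= `|b| * w ^+ 2 by rewrite ler_wpM2r ?sqr_ge0 ?ler_norm.
have : c * w ^+ 2 - d * w ^+ 4 <= c ^+ 2 / (4 * d).
  rewrite ler_pdivlMr ?mulr_gt0 //.
  have : 0 <= (c - 2 * d * w ^+ 2) ^+ 2 by rewrite sqr_ge0.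
  by rewrite (_ : w ^+ 4 = (w ^+ 2) ^+ 2) -?exprM //; nra.
by rewrite /c; lra.
Qed.

Section Comparison.
Variables (lam c C0 eps : R).
Hypotheses (lam0 : 0 < lam) (c0 : 0 <= c) (C00 : 0 <= C0) (eps0 : 0 < eps)
  (ceps : 24 * c * eps <= lam).

Section Sequence.
Variables (s : R) (u : nat -> R).
Hypotheses (s0 : 0 < s) (s1 : s <= 1) (u0 : u 0%N = 1).
Hypothesis (near : forall j, grid s j.+1 * s <= eps -> exists t, exists e,
  [/\ s * grid s j <= t, t <= s * grid s j.+1, `|e| <= c * (s ^+ 4 + t ^+ 4) &
      u j.+1 = u j * expR (- (lam / 3 * t ^+ 3) + e)]).

(** As long as s w is at most eps, the logarithm of u over the quartic exponential
    is controlled. The cubic terms of the error telescope, because (lam / 3) t^3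
    and the increment of (lam / 24) w^4 both lie between (lam / 3) s^3 w_j^3 and
    (lam / 3) s^3 w_{j+1}^3. *)
Lemma log_comparison j : grid s j * s <= eps -> exists2 E,
  u j = quartic_exp lam (grid s j) * expR E &
  `|E| <= lam / 3 * s ^+ 3 * grid s j ^+ 3 + c * (j%:R * (s ^+ 4 + s ^+ 4 * grid s j ^+ 4)).
Proof.
elim: j => [_|j IH js].
  exists 0; first by rewrite u0 /quartic_exp /grid mul0r expr0n /= mulr0 mul0r !expR0 mulr1.
  by rewrite /grid !mul0r !mulr0 normr0 expr0n /= mulr0 addr0.
have sj : grid s j * s <= eps.
  by apply: le_trans js; rewrite ler_wpM2r ?(ltW s0) ?grid_le ?(ltW s0).
have [E uE Eb] := IH sj.
have [t [e [t1 t2 eb uS]]] := near js.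
set w := grid s j in sj uE Eb t1; set w' := grid s j.+1 in js t2 uS *.
have w0 : 0 <= w by apply: grid_ge0; apply: ltW.
have s3 : 0 < s ^+ 3 by rewrite exprn_gt0.
have w'E : w' = w + 2 * s ^+ 3 by apply: gridS.
have ww' : w <= w' by rewrite w'E; lra.
have w'0 : 0 <= w' by lra.
have t0 : 0 <= t by apply: le_trans t1; rewrite mulr_ge0 ?(ltW s0).
have tw3 : s ^+ 3 * w ^+ 3 <= t ^+ 3.
  by rewrite -exprMn lerXn2r ?nnegrE ?mulr_ge0 ?(ltW s0).
have tw'3 : t ^+ 3 <= s ^+ 3 * w' ^+ 3.
  by rewrite -exprMn lerXn2r ?nnegrE ?mulr_ge0 ?(ltW s0).
have tw'4 : t ^+ 4 <= s ^+ 4 * w' ^+ 4.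
  by rewrite -exprMn lerXn2r ?nnegrE ?mulr_ge0 ?(ltW s0).
(* D is the discrepancy of the two leading terms in the step from w to w'. *)
pose D := lam / 24 * (w' ^+ 4 - w ^+ 4) - lam / 3 * t ^+ 3.
exists (E + D + e).
  by rewrite uS uE /quartic_exp -!expRD; congr expR; rewrite /D; field.
have w3 : w ^+ 3 <= w' ^+ 3 by rewrite lerXn2r ?nnegrE.
have w4 : w ^+ 4 <= w' ^+ 4 by rewrite lerXn2r ?nnegrE.
have d4 : w' ^+ 4 - w ^+ 4 = 2 * s ^+ 3 * (w' ^+ 3 + w' ^+ 2 * w + w' * w ^+ 2 + w ^+ 3).
  rewrite (_ : 2 * s ^+ 3 = w' - w); last by rewrite w'E; ring.
  ring.
have i1 : w ^+ 3 <= w' ^+ 2 * w /\ w' ^+ 2 * w <= w' ^+ 3.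
  have : w ^+ 2 <= w' ^+ 2 by rewrite lerXn2r ?nnegrE.
  split; first by rewrite exprSr ler_wpM2r.
  by rewrite [leRHS]exprSr ler_wpM2l ?sqr_ge0.
have i2 : w ^+ 3 <= w' * w ^+ 2 /\ w' * w ^+ 2 <= w' ^+ 3.
  have : w ^+ 2 <= w' ^+ 2 by rewrite lerXn2r ?nnegrE.
  split; first by rewrite exprS ler_wpM2r ?sqr_ge0.
  by rewrite [leRHS]exprS ler_wpM2l.
have low : 8 * s ^+ 3 * w ^+ 3 <= w' ^+ 4 - w ^+ 4.
  rewrite d4 (_ : 8 * s ^+ 3 * w ^+ 3 = 2 * s ^+ 3 * (4 * w ^+ 3)); last by ring.
  rewrite ler_wpM2l //; lra.
have up : w' ^+ 4 - w ^+ 4 <= 8 * s ^+ 3 * w' ^+ 3.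
  rewrite d4 (_ : 8 * s ^+ 3 * w' ^+ 3 = 2 * s ^+ 3 * (4 * w' ^+ 3)); last by ring.
  rewrite ler_wpM2l //; lra.
have Db : `|D| <= lam / 3 * s ^+ 3 * w' ^+ 3 - lam / 3 * s ^+ 3 * w ^+ 3.
  have l1 := ler_wpM2l (ltW lam0) low; have l2 := ler_wpM2l (ltW lam0) up.
  have l3 := ler_wpM2l (ltW lam0) tw3; have l4 := ler_wpM2l (ltW lam0) tw'3.
  rewrite ler_norml /D; apply/andP; split; lra.
have eb' : `|e| <= c * (s ^+ 4 + s ^+ 4 * w' ^+ 4).
  by apply: le_trans eb _; rewrite ler_wpM2l //; lra.
have Eb' : `|E| <= lam / 3 * s ^+ 3 * w ^+ 3 + c * (j%:R * (s ^+ 4 + s ^+ 4 * w' ^+ 4)).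
  apply: le_trans Eb _; rewrite lerD2l ler_wpM2l // ler_wpM2l //.
  by rewrite lerD2l ler_wpM2l // exprn_ge0 // ltW.
have := ler_normD (E + D) e; have := ler_normD E D.
have -> : j.+1%:R = j%:R + 1 :> R by rewrite -natr1.
set X := s ^+ 4 + s ^+ 4 * w' ^+ 4 in eb' Eb' *.
lra.
Qed.

Let A := 2 * lam + 61 * c.
Let B := lam / 3 * eps ^+ 3 + c * eps.

(** Two consequences of the previous bound: the error is at most a
    multiple of s exp w, and it is at most half of the exponent
    lam w^4 / 24, up to a constant. *)
Lemma log_comparison_bound j (E : R) : grid s j * s <= eps ->
  `|E| <= lam / 3 * s ^+ 3 * grid s j ^+ 3 + c * (j%:R * (s ^+ 4 + s ^+ 4 * grid s j ^+ 4)) ->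
  `|E| <= s * A * expR (grid s j) /\ `|E| <= B + lam / 48 * grid s j ^+ 4.
Proof.
move=> js Eb.
have w0 : 0 <= grid s j by apply: grid_ge0; apply: ltW.
have jE : j%:R * (s ^+ 4 + s ^+ 4 * grid s j ^+ 4) = grid s j * s / 2 * (1 + grid s j ^+ 4).
  by rewrite [in X in _ = X / 2 * _]/grid; field.
rewrite jE in Eb; set w := grid s j in js Eb w0 *.
have e3 := expr3_le_expR w0; have e5 := expr5_le_expR w0; have e1 := le_expR w.
have w3 : 0 <= w ^+ 3 by rewrite exprn_ge0.
have w4 : 0 <= w ^+ 4 by rewrite exprn_ge0.
split.
  apply: le_trans Eb _.
  have s3 : s ^+ 3 <= s by rewrite -[leRHS]expr1; apply: ler_wiXn2l => //; rewrite ltW.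
  have : lam / 3 * s ^+ 3 * w ^+ 3 <= s * (2 * lam) * expR w.
    apply: (@le_trans _ _ (lam / 3 * s * (6 * expR w))); last by lra.
    apply: ler_pM => //; first by rewrite mulr_ge0 ?exprn_ge0 ?(ltW s0) ?divr_ge0 ?(ltW lam0).
    by rewrite ler_wpM2l // divr_ge0 // ltW.
  have : c * (w * s / 2 * (1 + w ^+ 4)) <= s * (61 * c) * expR w.
    rewrite (_ : c * _ = s * c * ((w + w ^+ 5) / 2)); last by field.
    rewrite (_ : s * (61 * c) * expR w = s * c * (61 * expR w)); last by ring.
    by rewrite ler_wpM2l ?mulr_ge0 ?(ltW s0) //; lra.
  rewrite /A; lra.
apply: le_trans Eb _.
have : lam / 3 * s ^+ 3 * w ^+ 3 <= lam / 3 * eps ^+ 3.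
  rewrite -mulrA -exprMn ler_wpM2l ?divr_ge0 ?(ltW lam0) //.
  by rewrite lerXn2r ?nnegrE ?mulr_ge0 ?(ltW s0) ?(ltW eps0) // mulrC.
have : c * (w * s / 2 * (1 + w ^+ 4)) <= c * (eps / 2 * (1 + w ^+ 4)).
  rewrite ler_wpM2l // ler_wpM2r //; first by rewrite addr_ge0.
  lra.
have : c * (eps / 2 * w ^+ 4) <= lam / 48 * w ^+ 4.
  rewrite mulrA ler_wpM2r // (_ : c * (eps / 2) = 24 * c * eps / 48); last by field.
  by rewrite ler_pM2r.
have : 0 <= c * eps by rewrite mulr_ge0 // ltW.
rewrite /B; lra.
Qed.

Lemma near_upper j : grid s j * s <= eps ->
  u j <= expR B * expR (- (lam / 48 * grid s j ^+ 4)).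
Proof.
move=> js; have [E -> Eb] := log_comparison js.
have [_ E2] := log_comparison_bound js Eb.
rewrite /quartic_exp -!expRD ler_expR.
have := ler_norm E; lra.
Qed.

Lemma near_close j : grid s j * s <= eps ->
  `|u j - quartic_exp lam (grid s j)| <=
  s * (A * expR B) * expR (grid s j - lam / 48 * grid s j ^+ 4).
Proof.
move=> js; have [E -> Eb] := log_comparison js.
have [E1 E2] := log_comparison_bound js Eb.
rewrite -[X in _ - X]mulr1 -mulrBr normrM gtr0_norm ?expR_gt0 //.
apply: (@le_trans _ _ (quartic_exp lam (grid s j) *
  ((s * A * expR (grid s j)) * expR (B + lam / 48 * grid s j ^+ 4)))).
  rewrite ler_wpM2l ?expR_ge0 //; apply: le_trans (expR_sub1_le E) _.
  by apply: ler_pM; rewrite ?expR_ge0 // ler_expR.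
rewrite (_ : _ * _ = s * A * (quartic_exp lam (grid s j) * expR (grid s j) *
  expR (B + lam / 48 * grid s j ^+ 4))); last by ring.
rewrite (_ : s * (A * _) * _ = s * A * (expR B * expR (grid s j - lam / 48 * grid s j ^+ 4)));
  last by ring.
rewrite /quartic_exp -!expRD.
by rewrite (_ : _ + _ + _ = B + (grid s j - lam / 48 * grid s j ^+ 4)) //; field.
Qed.

End Sequence.

(** Let u start at 1, have ratios exp (- (lam / 3) t^3 + O(s^4 + t^4)) with t
    between s w_j and s w_{j+1} while s w_{j+1} <= eps, be decreasing up to a
    constant factor C0, and vanish when s w_j > 2. Then u is close to the
    quartic exponential along the whole grid, uniformly in s and u. *)
Lemma one_sided_comparison : exists2 C, 0 < C &
  forall (s : R) (u : nat -> R), 0 < s -> s <= 1 -> u 0%N = 1 ->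
  (forall j, 0 <= u j) ->
  (forall j, grid s j.+1 * s <= eps -> exists t, exists e,
    [/\ s * grid s j <= t, t <= s * grid s j.+1, `|e| <= c * (s ^+ 4 + t ^+ 4) &
      u j.+1 = u j * expR (- (lam / 3 * t ^+ 3) + e)]) ->
  (forall i j, (i <= j)%N -> u j <= C0 * u i) ->
  (forall j, 2 < grid s j * s -> u j = 0) ->
  forall j, `|u j - quartic_exp lam (grid s j)| <= C * s * envelope (grid s j).
Proof.
pose A := 2 * lam + 61 * c; pose B := lam / 3 * eps ^+ 3 + c * eps.
have lpos := lam0; have cpos := c0.
have A0 : 0 <= A by rewrite /A; lra.
have lam48 : 0 < lam / 48 by lra.
have lam24 : 0 < lam / 24 by lra.
have [C1 C10 H1] := quartic_absorb 2 2 lam48.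
have [C2 C20 H2] := quartic_absorb 2 2 lam24.
have [C3 C30 H3] := quartic_absorb (3 / eps) (16 / eps ^+ 2) lam48.
pose K3 := expR (64 / eps ^+ 2 + 6 / eps) * C3.
exists (A * expR B * C1 + C2 / eps + C0 * expR B * K3).
  rewrite -addrA addrC; apply: ltr_wpDr; first by rewrite !mulr_ge0 ?expR_ge0 ?(ltW C10).
  by apply: ltr_wpDr; [rewrite !mulr_ge0 ?expR_ge0 ?(ltW C30)|rewrite divr_gt0].
move=> s u s0 s1 u0 upos near far vanish j.
set w := grid s j.
have w0 : 0 <= w by apply: grid_ge0; apply: ltW.
have P1 : 0 <= A * expR B * C1 by rewrite !mulr_ge0 ?expR_ge0 ?(ltW C10).
have P2 : 0 <= C2 / eps by rewrite divr_ge0 // ltW.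
have P3 : 0 <= C0 * expR B * K3 by rewrite !mulr_ge0 ?expR_ge0 ?(ltW C30).
have en0 : 0 <= s * envelope w by rewrite mulr_ge0 ?expR_ge0 ?(ltW s0).
have [js|js] := leP (w * s) eps.
  apply: le_trans (near_close s0 s1 u0 near js) _.
  rewrite -/w -/A -/B.
  apply: (@le_trans _ _ (A * expR B * C1 * (s * envelope w))); last first.
    by rewrite -[leRHS]mulrA ler_wpM2r //; lra.
  rewrite (_ : s * _ * _ = A * expR B * s * expR (w - lam / 48 * w ^+ 4)); last by ring.
  rewrite (_ : A * expR B * C1 * _ = A * expR B * s * (C1 * envelope w)); last by ring.
  rewrite ler_wpM2l ?mulr_ge0 ?expR_ge0 ?(ltW s0) //.
  rewrite (_ : w - lam / 48 * w ^+ 4 =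
    (2 * w + 2 * w ^+ 2 - lam / 48 * w ^+ 4) + - (2 * w ^+ 2 + w)); last by ring.
  by rewrite expRD ler_wpM2r ?expR_ge0 // H1.
(* Outside the near range s > eps / w, so that exponentially small terms are
   bounded by multiples of s. *)
have psiB : quartic_exp lam w <= C2 / eps * (s * envelope w).
  have w1 : 1 <= s * expR w / eps.
    rewrite ler_pdivlMr // mul1r; apply: le_trans (ltW js) _.
    by rewrite mulrC ler_wpM2l ?(ltW s0) ?le_expR.
  apply: (@le_trans _ _ (s * expR w / eps * quartic_exp lam w)).
    by rewrite -[leLHS]mul1r ler_wpM2r ?expR_ge0.
  rewrite (_ : _ * _ = s / eps * (expR w * quartic_exp lam w)); last by ring.
  rewrite (_ : C2 / eps * _ = s / eps * (C2 * envelope w)); last by ring.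
  rewrite ler_wpM2l ?divr_ge0 ?(ltW s0) ?(ltW eps0) // -expRD.
  rewrite (_ : w + - lam * w ^+ 4 / 24 =
    (2 * w + 2 * w ^+ 2 - lam / 24 * w ^+ 4) + - (2 * w ^+ 2 + w)); last by field.
  by rewrite expRD ler_wpM2r ?expR_ge0 // H2.
have uB : u j <= C0 * expR B * K3 * (s * envelope w).
  have [big|small] := ltP 2 (w * s); first by rewrite vanish // mulr_ge0.
  (* w_i is the last grid point of the near range; there u is already bounded
     by exp (- lam w_i^4 / 48), with w_i of order eps / s. *)
  pose i := Num.truncn (eps / (2 * s ^+ 4)).
  have s4 : 0 < 2 * s ^+ 4 by rewrite mulr_gt0 ?exprn_gt0.
  have /andP[i1 i2] : i%:R <= eps / (2 * s ^+ 4) < i.+1%:R.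
    by apply: truncn_itv; rewrite divr_ge0 ?ltW.
  have gi k : grid s k * s = k%:R * (2 * s ^+ 4) by rewrite /grid; ring.
  have wi1 : grid s i * s <= eps by rewrite gi -ler_pdivlMr.
  have wi2 : eps < grid s i.+1 * s by rewrite gi -ltr_pdivrMr.
  have ij : (i <= j)%N.
    rewrite leqNgt; apply/negP => /ltnW ji.
    have : w * s <= grid s i * s by rewrite ler_wpM2r ?(ltW s0) // grid_le // ltW.
    lra.
  apply: le_trans (far i j ij) _.
  rewrite -2!mulrA ler_wpM2l //.
  apply: le_trans (near_upper s0 s1 u0 near wi1) _.
  rewrite ler_wpM2l ?expR_ge0 //.
  set x := grid s i in wi1 wi2 *.
  have x0 : 0 <= x by apply: grid_ge0; apply: ltW.
  pose v := s^-1.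
  have v0 : 0 < v by rewrite invr_gt0.
  have sv : s * v = 1 by rewrite divff ?gt_eqF.
  have vx : v <= (x + 2) / eps.
    rewrite ler_pdivlMr // mulrC ler_pdivrMr //.
    apply: le_trans (ltW wi2) _; rewrite gridS -/x ler_wpM2r ?(ltW s0) // lerD2l.
    by rewrite ger_pMr // exprn_ile1 // ltW.
  have wv : w <= 2 * v by rewrite -ler_pdivrMr ?invr_gt0 // invrK.
  have main : 8 * v ^+ 2 + 3 * v - lam / 48 * x ^+ 4 <=
      (64 / eps ^+ 2 + 6 / eps) + (3 / eps * x + 16 / eps ^+ 2 * x ^+ 2 - lam / 48 * x ^+ 4).
    have v2 : v ^+ 2 <= 2 * (x ^+ 2 + 4) / eps ^+ 2.
      apply: (@le_trans _ _ (((x + 2) / eps) ^+ 2)).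
        by rewrite lerXn2r ?nnegrE ?(ltW v0) ?divr_ge0 ?(ltW eps0) // addr_ge0.
      rewrite expr_div_n ler_wpM2r ?invr_ge0 ?sqr_ge0 //.
      have : 0 <= (x - 2) ^+ 2 by rewrite sqr_ge0.
      lra.
    lra.
  have K3b : expR (8 * v ^+ 2 + 3 * v - lam / 48 * x ^+ 4) <= K3.
    apply: (@le_trans _ _ _ _ _ (_ : expR _ <= expR _)); first by rewrite ler_expR; exact: main.
    by rewrite expRD ler_wpM2l ?expR_ge0 ?H3.
  apply: (@le_trans _ _
    (expR (8 * v ^+ 2 + 3 * v - lam / 48 * x ^+ 4) * (s * envelope w))); last first.
    by rewrite ler_wpM2r.
  rewrite [X in expR X <= _](_ : _ = (8 * v ^+ 2 + 3 * v - lam / 48 * x ^+ 4)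
    + - (8 * v ^+ 2 + 3 * v)); last by ring.
  rewrite expRD ler_wpM2l ?expR_ge0 //.
  apply: (@le_trans _ _ (s * expR v * expR (- (8 * v ^+ 2 + 3 * v)))).
    rewrite -[leLHS]mul1r ler_wpM2r ?expR_ge0 // -sv ler_wpM2l ?(ltW s0) //.
    exact: le_expR.
  rewrite -[leLHS]mulrA ler_wpM2l ?(ltW s0) // -expRD ler_expR.
  have : w ^+ 2 <= (2 * v) ^+ 2.
    by rewrite lerXn2r ?nnegrE // mulr_ge0 // ltW.
  lra.
apply: le_trans (ler_normB _ _) _.
rewrite ger0_norm ?upos // ger0_norm ?expR_ge0 // -mulrA.
apply: le_trans (lerD uB psiB) _.
rewrite -mulrDl ler_wpM2r //; lra.
Qed.

End Comparison.
End OneSided.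

(** * From local comparison to tail sums *)

Section TailComparison.
Variable R : realType.
Implicit Types (s x y z w lam K : R) (T : R -> R) (u : nat -> R).

(** T behaves like the tail function z |-> P(Z > z), z >= 0, of a law whose
    density on the half-line is K times the quartic exponential: T is
    nonnegative, its increments are bounded by the extreme values of the
    density, and T takes arbitrarily small values. *)
Definition quartic_tail lam K T : Prop :=
  [/\ forall z, 0 <= T z,
      forall x y, 0 <= x -> x <= y ->
        K * (y - x) * quartic_exp lam y <= T x - T y /\
        T x - T y <= K * (y - x) * quartic_exp lam x
    & forall e, 0 < e -> exists2 x, 0 <= x & T x <= e].

Lemma quartic_exp_le lam x y : 0 <= lam -> 0 <= x -> x <= y ->
  quartic_exp lam y <= quartic_exp lam x.
Proof.
move=> l0 x0 xy; rewrite ler_expR ler_pM2r // !mulNr lerN2 ler_wpM2l //.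
by rewrite lerXn2r ?nnegrE // (le_trans x0).
Qed.

Lemma quartic_tail_le lam K T x y : 0 <= K -> quartic_tail lam K T ->
  0 <= x -> x <= y -> T y <= T x.
Proof.
move=> K0 [_ Tb _] x0 xy; have [h _] := Tb x y x0 xy.
rewrite -subr_ge0; apply: le_trans h.
by rewrite !mulr_ge0 ?expR_ge0 // subr_ge0.
Qed.

Lemma step_exp_sum s (a N : nat) : 0 < s -> (a <= N)%N ->
  \sum_(a <= j < N) 2 * s ^+ 3 * expR (- grid s j) <=
  (1 + 2 * s ^+ 3) * (expR (- grid s a) - expR (- grid s N)).
Proof.
move=> s0; have s3 : 0 < 2 * s ^+ 3 by rewrite mulr_gt0 ?exprn_gt0.
elim: N => [|N IH aN].
  by rewrite leqn0 => /eqP ->; rewrite big_geq // subrr mulr0.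
move: aN; rewrite leq_eqVlt => /orP[/eqP ->|aN].
  by rewrite big_geq // subrr mulr0.
rewrite big_nat_recr //=; apply: le_trans (lerD (IH aN) (lexx _)) _.
rewrite gridS opprD expRD.
set d := 2 * s ^+ 3 in s3 *; set E := expR (- grid s N).
have E0 : 0 < E by rewrite expR_gt0.
have : (1 + d) * expR (- d) <= 1.
  by rewrite expRN ler_pdivrMr ?expR_gt0 // mul1r expR_ge1Dx.
nra.
Qed.

Lemma envelope_sum s (a N : nat) : 0 < s -> s <= 1 ->
  \sum_(a <= j < N) 2 * s ^+ 3 * envelope (grid s j) <=
  3 * expR (- (2 * grid s a ^+ 2)).
Proof.
move=> s0 s1; have s3 : 0 < 2 * s ^+ 3 by rewrite mulr_gt0 ?exprn_gt0.
have [Na|aN] := leqP N a; first by rewrite big_geq // mulr_ge0 ?expR_ge0.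
have wa0 : 0 <= grid s a by apply: grid_ge0; apply: ltW.
apply: (@le_trans _ _ (expR (- (2 * grid s a ^+ 2)) *
   \sum_(a <= j < N) 2 * s ^+ 3 * expR (- grid s j))).
  rewrite mulr_sumr; apply: ler_sum_nat => j /andP[aj _].
  rewrite [leRHS]mulrCA ler_wpM2l ?(ltW s3) // -expRD ler_expR.
  have : grid s a ^+ 2 <= grid s j ^+ 2.
    by rewrite lerXn2r ?nnegrE ?grid_ge0 ?grid_le // ltW.
  lra.
rewrite mulrC ler_wpM2r ?expR_ge0 //.
apply: le_trans (step_exp_sum s0 (ltnW aN)) _.
have s31 : s ^+ 3 <= 1 by rewrite exprn_ile1 // ltW.
have e1 : expR (- grid s a) <= 1 by rewrite -expR0 ler_expR; lra.
have e2 := expR_gt0 (- grid s N); have e3 := expR_gt0 (- grid s a).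
apply: (@le_trans _ _ ((1 + 2 * s ^+ 3) * 1)); last by lra.
by rewrite ler_wpM2l; lra.
Qed.

Section Comparison.
Variables (lam K C1 : R).

(** The sum over the cells between w_a and w_N. The difference between the mass of
    a cell and the mesh times the density at its left end is at most the mesh
    times the decrement of the density, which telescopes. *)
Lemma partial_sum_comparison T s u (a N : nat) :
  0 <= lam -> 0 <= K -> quartic_tail lam K T -> 0 < s ->
  (forall j, `|u j - quartic_exp lam (grid s j)| <= C1 * s * envelope (grid s j)) ->
  (a <= N)%N ->
  `|K * (2 * s ^+ 3) * (\sum_(a <= j < N) u j) - (T (grid s a) - T (grid s N))| <=
  K * C1 * s * (\sum_(a <= j < N) 2 * s ^+ 3 * envelope (grid s j)) +
  K * (2 * s ^+ 3) * (quartic_exp lam (grid s a) - quartic_exp lam (grid s N)).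
Proof.
move=> l0 K0 [T0 Tb Tlim] s0 ub.
have s3 : 0 < 2 * s ^+ 3 by rewrite mulr_gt0 ?exprn_gt0.
elim: N => [|N IH aN].
  by rewrite leqn0 => /eqP ->; rewrite !big_geq // !subrr !mulr0 subr0 addr0 normr0.
move: aN; rewrite leq_eqVlt => /orP[/eqP ->|aN].
  by rewrite !big_geq // !subrr !mulr0 subr0 addr0 normr0.
rewrite !big_nat_recr //=.
have H := IH aN.
have w0 : 0 <= grid s N by apply: grid_ge0; apply: ltW.
have ww' : grid s N <= grid s N.+1 by apply: grid_le => //; apply: ltW.
have [t1 t2] := Tb _ _ w0 ww'.
have dE : grid s N.+1 - grid s N = 2 * s ^+ 3 by rewrite gridS; ring.
rewrite dE in t1 t2.
have U := ub N.
have Kd : 0 <= K * (2 * s ^+ 3) by rewrite mulr_ge0 // ltW.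
have U' : `|K * (2 * s ^+ 3) * (u N - quartic_exp lam (grid s N))| <=
    K * (2 * s ^+ 3) * (C1 * s * envelope (grid s N)).
  by rewrite normrM ger0_norm // ler_wpM2l.
set X := K * (2 * s ^+ 3) in Kd t1 t2 U' H *.
set S := \sum_(a <= j < N) u j in H *.
set S' := \sum_(a <= j < N) _ in H *.
move: H U'; rewrite !ler_norml => /andP[h1 h2] /andP[v1 v2].
rewrite mulrDr mulrDr (_ : K * C1 * s * (2 * s ^+ 3 * envelope (grid s N)) =
  X * (C1 * s * envelope (grid s N))); last by rewrite /X; ring.
by apply/andP; split; lra.
Qed.

Lemma quartic_exp_absorb : 0 < lam -> exists2 C, 0 < C & forall w, 0 <= w ->
  quartic_exp lam w <= C * envelope w.
Proof.
move=> l0; have l24 : 0 < lam / 24 by lra.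
have [C C0 H] := quartic_absorb 1 2 l24; exists C => // w w0.
rewrite /quartic_exp (_ : _ / 24 = (1 * w + 2 * w ^+ 2 - lam / 24 * w ^+ 4)
  - (2 * w ^+ 2 + w)); last by field.
by rewrite expRD ler_wpM2r ?expR_ge0 // H.
Qed.

Lemma tail_sum_comparison : 0 < lam -> 0 < K -> 0 <= C1 -> exists2 C, 0 < C &
  forall T s u (N : nat), quartic_tail lam K T -> 0 < s -> s <= 1 ->
  (forall j, `|u j - quartic_exp lam (grid s j)| <= C1 * s * envelope (grid s j)) ->
  (forall j, (N <= j)%N -> u j = 0) ->
  forall a, `|K * (2 * s ^+ 3) * (\sum_(a <= j < N) u j) - T (grid s a)| <=
    C * s * expR (- (2 * grid s a ^+ 2)).
Proof.
move=> l0 K0 C10; have [C2 C20 H2] := quartic_exp_absorb l0.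
have P1 : 0 < 3 * K * C1 + 2 * K * C2.
  by apply: ltr_wpDl; rewrite ?mulr_ge0 ?mulr_gt0 // ltW.
exists (3 * K * C1 + 2 * K * C2) => // T s u N Ttail s0 s1 ub uN a.
have s3 : 0 < 2 * s ^+ 3 by rewrite mulr_gt0 ?exprn_gt0.
(* Cut the tail at a point w_M where T is at most e; u vanishes before it. *)
apply/ler_addgt0Pr => e e0.
have [T0 Tb Tlim] := Ttail.
have [x x0 Tx] := Tlim e e0.
pose M := (maxn a N + (Num.truncn (x / (2 * s ^+ 3))).+1)%N.
have aM : (a <= M)%N by apply: leq_trans (leq_maxl _ _) (leq_addr _ _).
have NM : (N <= M)%N by apply: leq_trans (leq_maxr _ _) (leq_addr _ _).
have xM : x <= grid s M.
  apply: ltW; rewrite /grid -ltr_pdivrMr //.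
  apply: (@lt_le_trans _ _ (Num.truncn (x / (2 * s ^+ 3))).+1%:R).
    have /andP[_ ->//] : (Num.truncn (x / (2 * s ^+ 3)))%:R <= x / (2 * s ^+ 3)
        < (Num.truncn (x / (2 * s ^+ 3))).+1%:R.
      by apply: truncn_itv; rewrite divr_ge0 // ltW.
  by rewrite ler_nat /M leq_addl.
have TM : T (grid s M) <= e.
  exact: le_trans (quartic_tail_le (ltW K0) Ttail x0 xM) Tx.
have -> : \sum_(a <= j < N) u j = \sum_(a <= j < M) u j.
  have [Na|aN] := leqP N a.
    rewrite [LHS]big_geq // big_nat_cond big1 // => j /andP[/andP[aj _] _].
    by apply: uN; apply: leq_trans Na aj.
  rewrite [RHS](big_cat_nat (n := N)) ?(ltnW aN) //=.
  rewrite [X in _ = _ + X]big_nat_cond [X in _ = _ + X]big1 ?addr0 //.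
  by move=> j /andP[/andP[Nj _] _]; apply: uN.
have H := partial_sum_comparison (ltW l0) (ltW K0) Ttail s0 ub aM.
have es := envelope_sum a M s0 s1.
have wa0 : 0 <= grid s a by apply: grid_ge0; apply: ltW.
set G := expR (- (2 * grid s a ^+ 2)) in es *.
have h1 : K * C1 * s * (\sum_(a <= j < M) 2 * s ^+ 3 * envelope (grid s j)) <=
    K * C1 * s * (3 * G).
  by rewrite ler_wpM2l // !mulr_ge0 // ltW.
have qa : quartic_exp lam (grid s a) <= C2 * G.
  apply: le_trans (H2 _ wa0) _; rewrite ler_wpM2l ?(ltW C20) // ler_expR; lra.
have h2 : K * (2 * s ^+ 3) * (quartic_exp lam (grid s a) - quartic_exp lam (grid s M)) <=
    K * (2 * s) * (C2 * G).
  have q0 := expR_ge0 (- lam * grid s M ^+ 4 / 24).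
  have s3s : s ^+ 3 <= s by rewrite -[leRHS]expr1; apply: ler_wiXn2l => //; rewrite ltW.
  apply: (@le_trans _ _ (K * (2 * s ^+ 3) * (C2 * G))).
    rewrite ler_wpM2l ?mulr_ge0 ?(ltW K0) ?exprn_ge0 ?(ltW s0) //.
    by apply: le_trans qa; rewrite lerBlDr lerDl.
  rewrite ler_wpM2r ?mulr_ge0 ?expR_ge0 ?(ltW C20) // ler_wpM2l ?(ltW K0) //; lra.
have TM0 := T0 (grid s M).
set S := K * (2 * s ^+ 3) * \sum_(a <= j < M) u j in H *.
move: H; rewrite !ler_norml => /andP[b1 b2].
by apply/andP; split; lra.
Qed.

(** Q selects the indices beyond z up to one mesh on either side, so that one
    statement covers strict and large inequalities and shifted grids. *)
Lemma tail_comparison : 0 < lam -> 0 < K -> 0 <= C1 -> exists2 C, 0 < C &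
  forall T s u (N : nat), quartic_tail lam K T -> 0 < s -> s <= 1 ->
  (forall j, `|u j - quartic_exp lam (grid s j)| <= C1 * s * envelope (grid s j)) ->
  (forall j, 0 <= u j) ->
  (forall j, (N <= j)%N -> u j = 0) ->
  forall z (Q : pred nat), 0 <= z ->
  (forall j, z + 2 * s ^+ 3 < grid s j -> Q j) ->
  (forall j, Q j -> z < grid s j.+1) ->
  `|K * (2 * s ^+ 3) * (\sum_(0 <= j < N | Q j) u j) - T z| <=
    C * s * expR (- z ^+ 2).
Proof.
move=> l0 K0 C10; have [C2 C20 H2] := tail_sum_comparison l0 K0 C10.
have [C3 C30 H3] := quartic_exp_absorb l0.
have P : 0 < (C2 + 4 * K * C3) * expR 8.
  by rewrite mulr_gt0 ?expR_gt0 // addr_gt0 // !mulr_gt0.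
exists ((C2 + 4 * K * C3) * expR 8) => // T s u N Ttail s0 s1 ub u0 uN z Q z0 Q1 Q2.
have [T0 Tb Tlim] := Ttail.
have s3 : 0 < 2 * s ^+ 3 by rewrite mulr_gt0 ?exprn_gt0.
have s3s : s ^+ 3 <= s by rewrite -[leRHS]expr1; apply: ler_wiXn2l => //; rewrite ltW.
have H := H2 T s u N Ttail s0 s1 ub uN.
(* The index A satisfies w_A <= z < w_{A+1}; the sum over Q is squeezed between the
   sums from A + 2 and from A. *)
pose A := Num.truncn (z / (2 * s ^+ 3)).
have /andP[A1 A2] : A%:R <= z / (2 * s ^+ 3) < A.+1%:R.
  by apply: truncn_itv; rewrite divr_ge0 // ltW.
have wA : grid s A <= z by rewrite /grid -ler_pdivlMr.
have wA1 : z < grid s A.+1 by rewrite /grid -ltr_pdivrMr.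
have wA0 : 0 <= grid s A by apply: grid_ge0; apply: ltW.
have wA2 : z <= grid s A.+2.
  by apply: ltW; apply: lt_le_trans wA1 _; apply: grid_le => //; apply: ltW.
have widen a : \sum_(a <= j < N) u j = \sum_(0 <= j < N) (if (a <= j)%N then u j else 0).
  by rewrite (big_nat_widenl a 0%N) //= big_mkcond.
have up : \sum_(0 <= j < N | Q j) u j <= \sum_(A <= j < N) u j.
  rewrite widen [X in X <= _]big_mkcond /=.
  apply: ler_sum_nat => j _; have [Qj|] := boolP (Q j); last by case: ifP.
  rewrite ifT // -ltnS -(ltr_nat R).
  apply: le_lt_trans A1 _; rewrite ltr_pdivrMr //; exact: Q2.
have low : \sum_(A.+2 <= j < N) u j <= \sum_(0 <= j < N | Q j) u j.
  rewrite widen [leRHS]big_mkcond /=.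
  apply: ler_sum_nat => j _; case: ifP => Aj; last by case: ifP.
  rewrite ifT // Q1 //; apply: (@lt_le_trans _ _ (grid s A.+2)); last first.
    by apply: grid_le => //; apply: ltW.
  by rewrite gridS ltrD2r.
have HA := H A; have HA2 := H A.+2.
have G2 : expR (- (2 * grid s A.+2 ^+ 2)) <= expR (- (2 * grid s A ^+ 2)).
  rewrite ler_expR lerN2 ler_pM2l // lerXn2r ?nnegrE ?grid_ge0 ?(ltW s0) //.
  by rewrite grid_le ?(ltW s0) // -addn2 leq_addr.
have Gz : expR (- (2 * grid s A ^+ 2)) <= expR 8 * expR (- z ^+ 2).
  rewrite -expRD ler_expR.
  have z2 : z <= grid s A + 2.
    apply: le_trans (ltW wA1) _; rewrite gridS lerD2l.
    by rewrite ger_pMr // exprn_ile1 // ltW.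
  have : z ^+ 2 <= (grid s A + 2) ^+ 2 by rewrite lerXn2r ?nnegrE // addr_ge0.
  have : 0 <= (grid s A - 2) ^+ 2 by rewrite sqr_ge0.
  lra.
have qA : quartic_exp lam (grid s A) <= C3 * expR (- (2 * grid s A ^+ 2)).
  apply: le_trans (H3 _ wA0) _; rewrite ler_wpM2l ?(ltW C30) // ler_expR; lra.
have [_ t1] := Tb _ _ wA0 (grid_le (ltW s0) (leqW (leqnSn A))).
have t2 := quartic_tail_le (ltW K0) Ttail wA0 wA.
have t3 := quartic_tail_le (ltW K0) Ttail z0 wA2.
rewrite (_ : grid s A.+2 - grid s A = 4 * s ^+ 3) in t1; last by rewrite !gridS; ring.
have t4 : T (grid s A) - T (grid s A.+2) <= 4 * K * C3 * s * expR (- (2 * grid s A ^+ 2)).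
  apply: le_trans t1 _.
  rewrite (_ : 4 * K * C3 * s * _ = K * (4 * s) * (C3 * expR (- (2 * grid s A ^+ 2)))); last by ring.
  apply: ler_pM => //; rewrite ?expR_ge0 ?mulr_ge0 ?exprn_ge0 ?(ltW K0) ?(ltW s0) //.
  by rewrite ler_wpM2l ?(ltW K0) //; lra.
have Kd : 0 <= K * (2 * s ^+ 3) by rewrite mulr_ge0 ?ltW.
have up' := ler_wpM2l Kd up; have low' := ler_wpM2l Kd low.
have HA2' : `|K * (2 * s ^+ 3) * (\sum_(A.+2 <= j < N) u j) - T (grid s A.+2)| <=
    C2 * s * expR (- (2 * grid s A ^+ 2)).
  by apply: le_trans HA2 _; rewrite ler_wpM2l // mulr_ge0 // ltW.
set G := expR (- (2 * grid s A ^+ 2)) in HA HA2' t4 Gz.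
have fin : (C2 + 4 * K * C3) * s * G <= (C2 + 4 * K * C3) * expR 8 * s * expR (- z ^+ 2).
  rewrite (_ : _ * expR 8 * s * _ = (C2 + 4 * K * C3) * s * (expR 8 * expR (- z ^+ 2))); last by ring.
  by rewrite ler_wpM2l // mulr_ge0 ?(ltW s0) // addr_ge0 ?mulr_ge0 ?(ltW K0) ?(ltW C20) ?(ltW C30).
apply: le_trans fin.
move: HA HA2'; rewrite !ler_norml => /andP[a1 a2] /andP[b1 b2].
by apply/andP; split; lra.
Qed.

End Comparison.

(** Gaussian bound on the tails: this is tail_comparison for s = 1 and u = 0,
    the quartic exponential being itself below a multiple of the envelope. *)
Lemma quartic_tail_bound lam K : 0 < lam -> 0 < K -> exists2 C, 0 < C &
  forall T z, quartic_tail lam K T -> 0 <= z -> T z <= C * expR (- z ^+ 2).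
Proof.
move=> l0 K0; have [C1 C10 H1] := quartic_exp_absorb l0.
have [C C0 H] := tail_comparison l0 K0 (ltW C10).
exists C => // T z Ttail z0.
have ub j : `|0 - quartic_exp lam (grid 1 j)| <= C1 * 1 * envelope (grid (1 : R) j).
  rewrite sub0r normrN ger0_norm ?expR_ge0 // mulr1; apply: H1.
  exact: grid_ge0.
have Q1 j : z + 2 * 1 ^+ 3 < grid 1 j -> z < grid 1 j.+1.
  by rewrite gridS; lra.
have := H T 1 (fun=> 0) 0%N Ttail ltr01 (lexx 1) ub (fun=> lexx 0) (fun _ _ => erefl)
  z (fun j => z < grid 1 j.+1) z0 Q1 (fun _ => id).
by rewrite big_geq // mulr0 sub0r normrN mulr1 ger0_norm //; case: Ttail.
Qed.

End TailComparison.

(** * Tails of the limiting law *)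

Section QuarticLaw.
Variable R : realType.
Local Notation lam := (@lambda_c R).
Local Notation K := (@quartic_const R).

Lemma measurable_quartic_density (D : set R) : measurable_fun D (@quartic_density R).
Proof.
apply: measurable_funM; first exact: measurable_cst.
apply: (measurableT_comp (@measurable_expR R)).
apply: measurable_funM; last exact: measurable_cst.
apply: measurable_funM; first exact: measurable_cst.
by apply: measurable_funX; exact: measurable_id.
Qed.

(** The real-valued integral is 0 when the extended one is infinite, so that K is
    nonnegative in any case. *)
Lemma quartic_const_ge0 : 0 <= K.
Proof.
rewrite invr_ge0; apply: fine_ge0; apply: integral_ge0 => x _.
by rewrite lee_fin expR_ge0.
Qed.

Section Law.
Variables (d : measure_display) (T : measurableType d) (P : probability T R)
  (Y : {RV P >-> R}).
Hypothesis densY : has_density Y (@quartic_density R).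

(** If K were 0 the density would vanish, and the total mass would not be 1. *)
Lemma quartic_const_gt0 : 0 < K.
Proof.
rewrite lt0r quartic_const_ge0 andbT; apply/eqP => K0.
have := densY (@measurableT _ R).
rewrite /distribution /pushforward /= preimage_setT probability_setT.
rewrite (eq_integral (fun=> 0%E)); last by move=> x _; rewrite /quartic_density K0 mul0r.
rewrite integral0 => /eqP; by rewrite onee_eq0.
Qed.

(** Probability of an interval, from bounds on the density over it. *)
Lemma distribution_itv_bounds (a b lo hi : R) : a <= b -> 0 <= lo ->
  (forall x, a < x -> x <= b -> lo <= quartic_exp lam x <= hi) ->
  K * (b - a) * lo <= fine (distribution P Y `]a, b]) <= K * (b - a) * hi.
Proof.
move=> ab lo0 H.
have [->|/eqP neq] := eqVneq a b.
  by rewrite set_itv_ge ?bnd_simp // measure0 subrr !(mulr0, mul0r) lexx.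
have altb : a < b by rewrite lt_neqAle ab andbT; apply/eqP.
have K0 := quartic_const_ge0.
have mI : measurable (`]a, b] : set R) by exact: measurable_itv.
have fd : distribution P Y `]a, b] \is a fin_num by apply: fin_num_measure.
have hi0 : 0 <= hi.
  have /andP[h1 h2] := H b altb (lexx b); exact: le_trans lo0 (le_trans h1 h2).
have cstE (c : R) : (\int[lebesgue_measure]_(x in `]a, b]) (K * c)%:E =
    (K * (b - a) * c)%:E)%E.
  transitivity ((K * c)%:E * lebesgue_measure (`]a, b] : set R))%E.
    exact: integral_cst.
  rewrite lebesgue_measure_itv /= lte_fin altb -EFinD -EFinM.
  by congr (_%:E); ring.
have mq : measurable_fun `]a, b] (EFin \o (@quartic_density R)).
  apply/measurable_EFinP; exact: measurable_quartic_density.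
rewrite -!lee_fin fineK // densY // -!cstE; apply/andP; split.
  apply: ge0_le_integral => //.
  - by move=> x _; rewrite lee_fin mulr_ge0.
  - move=> x /=; rewrite in_itv /= => /andP[xa xb].
    by rewrite lee_fin ler_wpM2l //; case/andP: (H x xa xb).
apply: ge0_le_integral => //.
- by move=> x _; rewrite lee_fin mulr_ge0 ?expR_ge0.
- move=> x /=; rewrite in_itv /= => /andP[xa xb].
  by rewrite lee_fin ler_wpM2l //; case/andP: (H x xa xb).
Qed.

Lemma distribution_itvB (a b : R) : a <= b ->
  fine (cdf Y b) - fine (cdf Y a) = fine (distribution P Y `]a, b]).
Proof.
move=> ab.
have -> : cdf Y b = (cdf Y a + distribution P Y `]a, b])%E.
  rewrite /cdf -measureU //=.
  - congr (distribution P Y _); apply/seteqP; split => x /=; rewrite !in_itv /=.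
      by move=> xb; case: (leP x a) => xa; [left|right].
    by case=> [xa|/andP[]//]; apply: le_trans xa ab.
  - apply/seteqP; split => x //= -[]; rewrite !in_itv /= => xa /andP[ax _]; lra.
by rewrite fineD ?fin_num_measure // addrAC subrr add0r.
Qed.

Lemma right_tail : quartic_tail lam K (fun z => 1 - fine (cdf Y z)).
Proof.
split.
- move=> z; rewrite subr_ge0 -lee_fin fineK ?fin_num_measure //.
  exact: cdf_le1.
- move=> x y x0 xy.
  rewrite (_ : _ - _ - _ = fine (cdf Y y) - fine (cdf Y x)); last by ring.
  rewrite distribution_itvB //; apply/andP; apply: distribution_itv_bounds => //.
    exact: expR_ge0.
  move=> t xt ty; have l0 := ltW (lambda_c_gt0 R).
  by apply/andP; split; apply: quartic_exp_le => //; lra.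
- move=> e e0.
  have : fine (cdf Y x) @[x --> +oo] --> (1 : R) by exact/fine_cvg/cvg_cdfy1.
  move=> /cvgrPdist_le /(_ e e0) [M [_ HM]].
  exists (Num.max 0 (M + 1)); first by rewrite le_max lexx.
  apply: le_trans (HM _ _); first exact: ler_norm.
  by rewrite lt_max ltrDl ltr01 orbT.
Qed.

Lemma left_tail : quartic_tail lam K (fun z => fine (cdf Y (- z))).
Proof.
split.
- by move=> z; apply: fine_ge0; apply: cdf_ge0.
- move=> x y x0 xy.
  rewrite distribution_itvB; last by rewrite lerN2.
  rewrite (_ : y - x = - x - - y); last by ring.
  apply/andP; apply: distribution_itv_bounds; rewrite ?lerN2 ?expR_ge0 //.
  move=> t xt ty; have l0 := ltW (lambda_c_gt0 R).
  rewrite (_ : quartic_exp lam t = quartic_exp lam (- t)); last first.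
    by rewrite /quartic_exp exprNn -signr_odd /= mul1r.
  by apply/andP; split; apply: quartic_exp_le => //; lra.
- move=> e e0.
  have : fine (cdf Y x) @[x --> -oo] --> (0 : R) by exact/fine_cvg/cvg_cdfNy0.
  move=> /cvgrPdist_le /(_ e e0) [M [_ HM]].
  exists (Num.max 0 (- M + 1)); first by rewrite le_max lexx.
  have -> : fine (cdf Y (- Num.max 0 (- M + 1))) = `|0 - fine (cdf Y (- Num.max 0 (- M + 1)))|.
    by rewrite sub0r normrN ger0_norm // fine_ge0 // cdf_ge0.
  apply: HM; rewrite /= ltrNl lt_max ltrDl ltr01 orbT //.
Qed.

End Law.
End QuarticLaw.

(** * The normalised weights on the two sides of the critical density *)

Section Reindexing.
Variable R : realType.
Implicit Types V : nat -> R.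

Lemma sum_upward V (k0 N : nat) : (forall j, V (k0 + j.*2.+1)%N = 0) ->
  \sum_(k0 <= k < k0 + N.*2) V k = \sum_(0 <= j < N) V (k0 + j.*2)%N.
Proof.
move=> V0; elim: N => [|N IH]; first by rewrite addn0 !big_geq.
rewrite doubleS !addnS !big_nat_recr //=; try lia.
by rewrite IH -addnS V0 addr0.
Qed.

Lemma sum_downward V (k0 N : nat) :
  (forall k, (k < k0)%N -> odd (k0 - k) -> V k = 0) ->
  \sum_(k0 - N.*2 <= k < k0) V k =
  \sum_(1 <= j < N.+1) (if (j.*2 <= k0)%N then V (k0 - j.*2)%N else 0).
Proof.
move=> V0; elim: N => [|N IH]; first by rewrite subn0 !big_geq.
rewrite [RHS]big_nat_recr // -IH; have [Nk|Nk] := leqP N.+1.*2 k0.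
  rewrite big_ltn; last lia.
  rewrite big_ltn; last lia.
  rewrite (V0 (k0 - N.+1.*2).+1); [|lia|]; last first.
    by rewrite (_ : k0 - (k0 - N.+1.*2).+1 = N.*2.+1)%N ?oddS ?odd_double //; lia.
  rewrite add0r [RHS]addrC (_ : (k0 - N.+1.*2).+2 = (k0 - N.*2)%N) //; lia.
rewrite [RHS]addr0; have [kN|kN] := leqP k0 N.*2.
  by congr (\sum_(_ <= _ < _) _); lia.
rewrite big_ltn; last lia.
rewrite (V0 (k0 - N.+1.*2)%N); [|lia|]; last first.
  by rewrite (_ : k0 - (k0 - N.+1.*2) = N.*2.+1)%N ?oddS ?odd_double //; lia.
by rewrite add0r; congr (\sum_(_ <= _ < _) _); lia.
Qed.

(** A sum over k <= n of terms supported on the parity class of k0, reorganised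
    into the steps of length 2 upwards and downwards from k0. *)
Lemma sum_two_sided V (n k0 : nat) : (k0 <= n)%N ->
  (forall k, (n < k)%N -> V k = 0) ->
  (forall k, (k <= n)%N -> odd (n - k) != odd (n - k0) -> V k = 0) ->
  \sum_(0 <= k < n.+1) V k =
  \sum_(0 <= j < n.+1) V (k0 + j.*2)%N +
  \sum_(1 <= j < n.+1) (if (j.*2 <= k0)%N then V (k0 - j.*2)%N else 0).
Proof.
move=> kn Vn Vodd.
have par k : (k <= n)%N -> odd (n - k) = odd n (+) odd k by move=> ?; rewrite oddB.
rewrite -sum_upward; last first.
  move=> j; have [jn|jn] := leqP (k0 + j.*2.+1) n; last by apply: Vn.
  apply: Vodd => //; rewrite !par // oddD oddS odd_double /=.
  by case: (odd n); case: (odd k0).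
rewrite -sum_downward; last first.
  move=> k kk0 ok; apply: Vodd; first lia.
  rewrite !par //; last lia.
  move: ok; rewrite oddB; last lia.
  by case: (odd n); case: (odd k0); case: (odd k).
rewrite (_ : k0 - n.*2 = 0)%N; last lia.
have -> : \sum_(k0 <= k < k0 + n.+1.*2) V k = \sum_(k0 <= k < n.+1) V k.
  rewrite (big_cat_nat (n := n.+1)) //=; [|lia|lia].
  rewrite [X in _ + X]big_nat_cond [X in _ + X]big1 ?addr0 //.
  by move=> k /andP[/andP[nk _] _]; apply: Vn.
by rewrite [LHS](big_cat_nat (n := k0)) //= 1?addrC //; lia.
Qed.

(** Iterated multiplicative bound along a sequence. *)
Lemma chain_le V (q : R) (i d : nat) : 0 <= q ->
  (forall j, (i <= j)%N -> V j.+1 <= q * V j) -> V (i + d)%N <= q ^+ d * V i.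
Proof.
move=> q0 H; elim: d => [|d IH]; first by rewrite addn0 expr0 mul1r.
rewrite addnS; apply: le_trans (H _ (leq_addr _ _)) _.
by rewrite exprS -mulrA ler_wpM2l.
Qed.

End Reindexing.

Section NormalizedWeights.
Variable R : realType.
Local Notation J := (@J_c R).
Local Notation h := (@h_c R).
Local Notation m := (@m_c R).
Local Notation lam := (@lambda_c R).

Variable n : nat.
Hypothesis n0 : (0 < n)%N.

Local Notation W := (monomer_weight J h n).

Lemma exists_central : exists k : nat,
  [&& (k <= n)%N, ~~ odd (n - k) & m * n%:R <= k%:R].
Proof.
exists n; rewrite leqnn subnn /=.
have [m1 m2] := m_c_bounds R.
have : 0 < n%:R :> R by rewrite ltr0n.
nra.
Qed.

(** The least number of monomers of the same parity as n whose density is at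
    least m_c; the two one-sided sequences start from it. *)
Definition central : nat := ex_minn exists_central.

Lemma centralP : [/\ (central <= n)%N, ~~ odd (n - central),
  m * n%:R <= central%:R & central%:R < m * n%:R + 2].
Proof.
rewrite /central; case: ex_minnP => k /and3P[kn ko mk] kmin; split => //.
have [m1 m2] := m_c_bounds R.
have nr : 0 < n%:R :> R by rewrite ltr0n.
have [k2|k2] := leqP 2 k; last first.
  have : k%:R <= 1 :> R by rewrite -[leRHS]/(1%:R) ler_nat.
  nra.
rewrite ltNge; apply/negP => kbig.
have : (k <= k - 2)%N.
  apply: kmin; apply/and3P; split; first lia.
    by rewrite (_ : n - (k - 2) = (n - k).+2)%N /= ?negbK //; lia.
  by rewrite natrB //; lra.
lia.
Qed.

Lemma central_weight_gt0 : 0 < W central.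
Proof. by have [? ? _ _] := centralP; apply: monomer_weight_gt0. Qed.

(** Weights read upwards from the central one, normalised to start at 1. *)
Definition right_weight (j : nat) : R := W (central + j.*2) / W central.

(** Weights read downwards from the central one, normalised to start at 1, and
    extended by 0 below k = 0. *)
Definition left_weight (j : nat) : R :=
  if (j.*2 <= central)%N then W (central - j.*2) / W central else 0.

Lemma right_weight0 : right_weight 0 = 1.
Proof. by rewrite /right_weight addn0 divff // gt_eqF // central_weight_gt0. Qed.

Lemma left_weight0 : left_weight 0 = 1.
Proof. by rewrite /left_weight /= subn0 divff // gt_eqF // central_weight_gt0. Qed.

Lemma right_weight_ge0 j : 0 <= right_weight j.
Proof. by rewrite divr_ge0 ?monomer_weight_ge0. Qed.

Lemma left_weight_ge0 j : 0 <= left_weight j.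
Proof. by rewrite /left_weight; case: ifP => // _; rewrite divr_ge0 ?monomer_weight_ge0. Qed.

Lemma right_weight_eq0 j : (n < j)%N -> right_weight j = 0.
Proof. by move=> nj; rewrite /right_weight monomer_weight_gt ?mul0r //; lia. Qed.

Lemma left_weight_eq0 j : (n < j)%N -> left_weight j = 0.
Proof.
by have [cn _ _ _] := centralP; move=> nj; rewrite /left_weight ifF //; lia.
Qed.

Lemma right_weightS j :
  right_weight j.+1 = right_weight j * weight_ratio R n (central + j.*2).
Proof.
rewrite /right_weight doubleS !addnS monomer_weightSS // -/(weight_ratio R n _).
by rewrite mulrAC.
Qed.

Lemma left_weightS j : (j.+1.*2 <= central)%N ->
  left_weight j = left_weight j.+1 * weight_ratio R n (central - j.+1.*2).
Proof.
move=> jc; rewrite /left_weight jc ifT; last lia.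
rewrite (_ : central - j.*2 = (central - j.+1.*2).+2)%N; last lia.
by rewrite monomer_weightSS // -/(weight_ratio R n _) mulrAC.
Qed.

Lemma sum_weights (F : pred nat) :
  \sum_(k < n.+1 | F k) W k = W central *
  (\sum_(0 <= j < n.+1 | F (central + j.*2)%N) right_weight j +
   \sum_(1 <= j < n.+1 | (j.*2 <= central)%N && F (central - j.*2)%N) left_weight j).
Proof.
have [cn co mc _] := centralP; have W0 := central_weight_gt0.
rewrite big_mkcond /= -(big_mkord xpredT (fun k => if F k then W k else 0)).
rewrite (sum_two_sided cn); first last.
- move=> k kn; rewrite (negbTE co) eqbF_neg negbK => ok.
  by rewrite monomer_weight_odd // if_same.
- by move=> k kn; rewrite monomer_weight_gt // if_same.
rewrite mulrDr; congr (_ + _); rewrite [in RHS]big_mkcond mulr_sumr.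
  apply: eq_bigr => j _; case: ifP => _; last by rewrite mulr0.
  by rewrite /right_weight mulrC divfK // gt_eqF.
apply: eq_bigr => j _; rewrite /left_weight; case: ifP => _ /=; last by rewrite mulr0.
case: ifP => _; last by rewrite mulr0.
by rewrite mulrC divfK // gt_eqF.
Qed.

Lemma natr_gt0 : 0 < n%:R :> R. Proof. by rewrite ltr0n. Qed.

Lemma exp_power_le (d : nat) : (d <= n)%N -> expR (6 / n%:R) ^+ d <= expR 6 :> R.
Proof.
move=> dn; rewrite -expRM_natl ler_expR mulrCA ler_piMr //.
by rewrite ler_pdivrMr ?natr_gt0 // mul1r ler_nat.
Qed.

Lemma right_weight_far i j : (i <= j)%N ->
  right_weight j <= expR 6 * right_weight i.
Proof.
move=> ij; have [cn co mc1 mc2] := centralP; have nr := natr_gt0.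
have [nj|jn] := ltnP n j.
  by rewrite right_weight_eq0 // mulr_ge0 ?expR_ge0 ?right_weight_ge0.
rewrite -(subnKC ij); apply: le_trans (chain_le (q := expR (6 / n%:R)) _ _ _) _.
- exact: expR_ge0.
- move=> l _; rewrite right_weightS mulrC.
  have [ln|ln] := leqP (central + l.*2) n; last first.
    by rewrite /right_weight monomer_weight_gt // !(mul0r, mulr0).
  rewrite ler_wpM2r ?right_weight_ge0 // weight_ratio_le //.
  rewrite ler_pdivlMr //; apply: le_trans mc1 _.
  by rewrite ler_nat leq_addr.
- by rewrite ler_wpM2r ?right_weight_ge0 // exp_power_le //; lia.
Qed.

(** The constant c1 only serves for the first step, which may start above m_c. *)
Lemma left_weight_far (c1 : R) : 0 < c1 ->
  (forall k : nat, (k.+2 <= n)%N -> k%:R / n%:R < m -> c1 <= weight_ratio R n k) ->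
  forall i j, (i <= j)%N -> left_weight j <= (1 + c1^-1) * expR 6 * left_weight i.
Proof.
move=> c10 Hc1 i j ij; have [cn co mc1 mc2] := centralP; have nr := natr_gt0.
have c1i : 0 < c1^-1 by rewrite invr_gt0.
have e61 : 1 <= expR 6 :> R by rewrite -expR0 ler_expR.
have [nj|jn] := ltnP n j.
  by rewrite left_weight_eq0 // !mulr_ge0 ?expR_ge0 ?left_weight_ge0 //; lra.
have pos a b : (1 <= a)%N -> (a <= b)%N -> (b <= n)%N ->
    left_weight b <= expR 6 * left_weight a.
  move=> a1 ab bn.
  rewrite -(subnKC ab); apply: le_trans (chain_le (q := expR (6 / n%:R)) _ _ _) _.
  - exact: expR_ge0.
  - move=> l al; have [lc|lc] := leqP l.+1.*2 central; last first.
      rewrite /left_weight ifF; last lia.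
      by rewrite mulr_ge0 ?expR_ge0 ?left_weight_ge0.
    rewrite [left_weight l]left_weightS // mulrCA ler_peMr ?left_weight_ge0 //.
    rewrite -[leLHS](expRxMexpNx_1 (6 / n%:R)) ler_wpM2l ?expR_ge0 //.
    apply: weight_ratio_ge => //.
    rewrite ler_pdivrMr //.
    have -> : (central - l.+1.*2).+2%:R = central%:R - 2 * l%:R :> R.
      rewrite (_ : (central - l.+1.*2).+2 = central - l.*2)%N; last lia.
      by rewrite natrB -?muln2 ?natrM; [ring|lia].
    have : 1 <= l%:R :> R by rewrite -[leLHS]/(1%:R) ler_nat (leq_trans a1).
    lra.
  - by rewrite ler_wpM2r ?left_weight_ge0 // exp_power_le //; lia.
have [i1|] := ltnP 0 i.
  apply: le_trans (pos i j i1 ij jn) _.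
  by rewrite ler_wpM2r ?left_weight_ge0 // ler_peMl ?expR_ge0 //; lra.
rewrite leqn0 => /eqP ->.
case: j ij jn => [|j] ij jn.
  by rewrite left_weight0 mulr1 mulr_ege1 //; lra.
apply: le_trans (pos 1%N j.+1 isT isT jn) _.
have : left_weight 1 <= c1^-1 * left_weight 0.
  have [lc|lc] := leqP 1.*2 central; last first.
    rewrite {1}/left_weight ifF; last lia.
    by rewrite mulr_ge0 ?left_weight_ge0 // ltW.
  rewrite [left_weight 0]left_weightS // mulrCA ler_peMr ?left_weight_ge0 //.
  rewrite mulrC ler_pdivlMr // mul1r Hc1 //; first lia.
  by rewrite ltr_pdivrMr // natrB // (_ : (1.*2)%:R = 2 :> R) //; lra.
rewrite left_weight0 !mulr1 => l1.
rewrite mulrC ler_pM2r ?expR_gt0 //; lra.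
Qed.

Variable s : R.
Hypotheses (s0 : 0 < s) (s1 : s <= 1) (s4 : s ^+ 4 = n%:R^-1).

(** In the density variable the grid has mesh 2 / n, which is one step in k. *)
Lemma gridE j : grid s j * s = 2 * j%:R / n%:R.
Proof. by rewrite -s4 /grid; ring. Qed.

Lemma drift_error (t e : R) : `|t| <= 1 / 10 -> `|e| <= 8 / n%:R ->
  `|drift (m + t) + e + lam / 3 * t ^+ 3| <= 36 * (s ^+ 4 + t ^+ 4).
Proof.
move=> t1 e1; have H := drift_cubic t1.
rewrite (_ : _ + _ + _ = (drift (m + t) + lam / 3 * t ^+ 3) + e); last by ring.
apply: le_trans (ler_normD _ _) _; rewrite s4.
have : 0 <= n%:R^-1 :> R by rewrite invr_ge0 ltW // natr_gt0.
lra.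
Qed.

Section Near.
Variable eps : R.
Hypothesis (eps1 : eps <= 1 / 10).

(** Here t is the distance of the density to m_c. It differs from s w_j by the
    offset of the central density, which lies between 0 and 2 / n. *)
Lemma right_weight_near j : grid s j.+1 * s <= eps -> exists t, exists e,
  [/\ s * grid s j <= t, t <= s * grid s j.+1, `|e| <= 36 * (s ^+ 4 + t ^+ 4) &
      right_weight j.+1 = right_weight j * expR (- (lam / 3 * t ^+ 3) + e)].
Proof.
have e10 := eps1.
move=> js; have [cn co mc1 mc2] := centralP; have nr := natr_gt0.
pose k := (central + j.*2)%N.
have kE : k%:R = central%:R + 2 * j%:R :> R by rewrite /k natrD -muln2 natrM; ring.
pose t : R := k%:R / n%:R - m.
have tE : t * n%:R = central%:R + 2 * j%:R - m * n%:R.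
  by rewrite /t mulrBl divfK ?gt_eqF // kE.
have t1 : s * grid s j <= t.
  rewrite mulrC gridE ler_pdivrMr // tE; lra.
have t2 : t <= s * grid s j.+1.
  rewrite mulrC gridE ler_pdivlMr // tE -natr1; lra.
have t0 : 0 <= t by apply: le_trans t1; rewrite mulr_ge0 ?grid_ge0 ?ltW.
have t10 : `|t| <= 1 / 10.
  by rewrite ger0_norm //; apply: le_trans t2 _; rewrite mulrC; lra.
have [e eb rE] := weight_ratio_near n0 (t10 : `|k%:R / n%:R - m| <= 1 / 10).
have mt : k%:R / n%:R = m + t by rewrite /t; ring.
exists t, (drift (m + t) + e + lam / 3 * t ^+ 3); split => //.
  exact: drift_error.
rewrite right_weightS -/k rE mt; congr (_ * expR _); ring.
Qed.

(** The ratio is read at the lower end of the step, so that t now differs from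
    s w_{j+1} by the offset of the central density. *)
Lemma left_weight_near j : grid s j.+1 * s <= eps -> exists t, exists e,
  [/\ s * grid s j <= t, t <= s * grid s j.+1, `|e| <= 36 * (s ^+ 4 + t ^+ 4) &
      left_weight j.+1 = left_weight j * expR (- (lam / 3 * t ^+ 3) + e)].
Proof.
have e10 := eps1.
move=> js; have [cn co mc1 mc2] := centralP; have nr := natr_gt0.
have [m1 m2] := m_c_bounds R.
have jc : (j.+1.*2 <= central)%N.
  rewrite -(ler_nat R) -muln2 natrM mulrC.
  apply: le_trans mc1; rewrite gridE ler_pdivrMr // in js.
  by apply: le_trans js _; rewrite ler_pM2r //; lra.
pose k := (central - j.+1.*2)%N.
have kE : k%:R = central%:R - 2 * j.+1%:R :> R.
  by rewrite /k natrB // -muln2 natrM; ring.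
pose t : R := m - k%:R / n%:R.
have tE : t * n%:R = m * n%:R - central%:R + 2 * j.+1%:R.
  by rewrite /t mulrBl divfK ?gt_eqF // kE; ring.
have t1 : s * grid s j <= t.
  rewrite mulrC gridE ler_pdivrMr // tE -natr1; lra.
have t2 : t <= s * grid s j.+1.
  rewrite mulrC gridE ler_pdivlMr // tE; lra.
have t0 : 0 <= t by apply: le_trans t1; rewrite mulr_ge0 ?grid_ge0 ?ltW.
have t10 : `|- t| <= 1 / 10.
  by rewrite normrN ger0_norm //; apply: le_trans t2 _; rewrite mulrC; lra.
have mt : k%:R / n%:R = m + - t by rewrite /t; ring.
have t10' : `|k%:R / n%:R - m| <= 1 / 10 by rewrite mt addrAC subrr add0r.
have [e eb rE] := weight_ratio_near n0 t10'.
exists t, (- (drift (m + - t) + e + lam / 3 * (- t) ^+ 3)); split => //.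
  rewrite normrN (_ : t ^+ 4 = (- t) ^+ 4); last by ring.
  exact: drift_error.
rewrite [left_weight j]left_weightS // -/k rE mt -mulrA -expRD.
rewrite (_ : _ + (_ - _) = 0); last by ring.
by rewrite expR0 mulr1.
Qed.
End Near.

End NormalizedWeights.

(** * The non-uniform bound *)

Section Assembly.
Variable R : realType.
Local Notation J := (@J_c R).
Local Notation h := (@h_c R).
Local Notation m := (@m_c R).
Local Notation lam := (@lambda_c R).

(** Passage from unnormalised to normalised sums: X A approximates T, and X L
    approximates 1. *)
Lemma ratio_comparison (X A L T C2 C3 c s e : R) : 0 < c -> 0 <= C2 -> 0 < s ->
  c <= X * L -> `|X * L - 1| <= 2 * C2 * s -> `|X * A - T| <= C2 * s * e ->
  0 <= T -> T <= C3 * e ->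
  `|A / L - T| <= (C2 + 2 * C2 * C3) / c * s * e.
Proof.
move=> c0 C20 s0 cXL XL1 XA T0 Te.
have XL0 : 0 < X * L by apply: lt_le_trans cXL.
have X0 : X != 0 by apply: contraTneq XL0 => ->; rewrite mul0r ltxx.
have L0 : L != 0 by apply: contraTneq XL0 => ->; rewrite mulr0 ltxx.
have -> : A / L - T = ((X * A - T) - T * (X * L - 1)) / (X * L).
  by field; rewrite X0 L0.
rewrite normrM normfV (gtr0_norm XL0) ler_pdivrMr //.
apply: (@le_trans _ _ ((C2 + 2 * C2 * C3) * s * e)).
  apply: le_trans (ler_normB _ _) _.
  rewrite (_ : (C2 + 2 * C2 * C3) * s * e = C2 * s * e + (C3 * e) * (2 * C2 * s)); last by ring.
  rewrite lerD // normrM ger0_norm //.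
  by apply: ler_pM.
have P : 0 <= (C2 + 2 * C2 * C3) * s * e.
  have e0 : 0 <= C2 * s * e by apply: le_trans XA; apply: normr_ge0.
  have : 0 <= (C3 * e) * (2 * C2 * s).
    by apply: mulr_ge0; [apply: le_trans T0 Te|rewrite !mulr_ge0 ?(ltW s0)].
  by rewrite (_ : (C2 + 2 * C2 * C3) * s * e = C2 * s * e + (C3 * e) * (2 * C2 * s)); [lra|ring].
rewrite (_ : _ / c * s * e * _ = (C2 + 2 * C2 * C3) * s * e * ((X * L) / c)); last by ring.
by rewrite ler_peMr // ler_pdivlMr // mul1r.
Qed.

(** The upper tail is used for z >= 0 and the lower tail for z > 0, on either side
    of 0. The partition function is bounded below for all n: by 1/2 when s is
    small, and by its central term otherwise. *)
Lemma weights_vs_tails (K : R) : 0 < K -> exists2 C, 0 < C &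
  forall (TR TL : R -> R), quartic_tail lam K TR -> quartic_tail lam K TL ->
  TR 0 + TL 0 = 1 ->
  forall (n : nat) (s : R), (0 < n)%N -> 0 < s -> s <= 1 -> s ^+ 4 = n%:R^-1 ->
  (forall z, 0 <= z ->
    `|(\sum_(k < n.+1 | s * z < k%:R / n%:R - m) monomer_weight J h n k) /
      (\sum_(k < n.+1) monomer_weight J h n k) - TR z| <= C * s * expR (- z ^+ 2)) /\
  (forall z, 0 < z ->
    `|(\sum_(k < n.+1 | k%:R / n%:R - m <= - (s * z)) monomer_weight J h n k) /
      (\sum_(k < n.+1) monomer_weight J h n k) - TL z| <= C * s * expR (- z ^+ 2)).
Proof.
move=> K0; have lam0 := lambda_c_gt0 R.
have [c1 c10 Hc1] := weight_ratio_lower R.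
pose eps : R := Num.min (1 / 10) (lam / (24 * 36)).
have eps1 : eps <= 1 / 10 by rewrite ge_min lexx.
have eps0 : 0 < eps by rewrite lt_min; apply/andP; split; lra.
have eps2 : 24 * 36 * eps <= lam.
  have : eps <= lam / (24 * 36) by rewrite ge_min lexx orbT.
  lra.
have c1i : 0 < c1^-1 by rewrite invr_gt0.
have C00 : 0 <= (1 + c1^-1) * expR 6 by rewrite mulr_ge0 ?expR_ge0 //; lra.
have c36 : 0 <= 36 :> R by [].
have [C1 C10 H1] := one_sided_comparison lam0 c36 C00 eps0 eps2.
have [C2 C20 H2] := tail_comparison lam0 K0 (ltW C10).
have [C3 C30 H3] := quartic_tail_bound lam0 K0.
(* Lower bound for the partition function: 1/2 when 4 C2 s <= 1, and otherwise
   2 K s^3, the contribution of the central weight. *)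
pose c : R := Num.min (1 / 2) (2 * K * (4 * C2)^-1 ^+ 3).
have c0 : 0 < c.
  rewrite lt_min; apply/andP; split; first lra.
  by rewrite !mulr_gt0 // ?exprn_gt0 ?invr_gt0 ?mulr_gt0.
exists ((C2 + 2 * C2 * C3) / c).
  by rewrite divr_gt0 // addr_gt0 // !mulr_gt0.
move=> TR TL HTR HTL TT n s n0 s0 s1 s4.
have [cn co mc1 mc2] := centralP R n0.
set N0 := central R n0 in cn co mc1 mc2 *.
have nr : 0 < n%:R :> R by rewrite ltr0n.
pose r := right_weight R n0; pose l := left_weight R n0.
have s3 : 0 < 2 * s ^+ 3 by rewrite mulr_gt0 ?exprn_gt0.
have rb j : `|r j - quartic_exp lam (grid s j)| <= C1 * s * envelope (grid s j).
  apply: H1 => //.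
  - exact: right_weight0.
  - by move=> i; apply: right_weight_ge0.
  - by move=> i; apply: right_weight_near.
  - move=> i i' ii'; apply: le_trans (right_weight_far R n0 ii') _.
    rewrite ler_wpM2r ?right_weight_ge0 // ler_peMl ?expR_ge0 //; lra.
  - move=> i; rewrite (gridE s4) ltr_pdivlMr // ltr_pM2l // ltr_nat.
    exact: right_weight_eq0.
have lb j : `|l j - quartic_exp lam (grid s j)| <= C1 * s * envelope (grid s j).
  apply: H1 => //.
  - exact: left_weight0.
  - by move=> i; apply: left_weight_ge0.
  - by move=> i; apply: left_weight_near.
  - by move=> i i' ii'; apply: (left_weight_far n0 c10 (Hc1 n)) ii'.
  - move=> i; rewrite (gridE s4) ltr_pdivlMr // ltr_pM2l // ltr_nat.
    exact: left_weight_eq0.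
have HR := H2 TR s r n.+1 HTR s0 s1 rb (right_weight_ge0 R n0) (@right_weight_eq0 R n n0).
have HL := H2 TL s l n.+1 HTL s0 s1 lb (left_weight_ge0 R n0) (@left_weight_eq0 R n n0).
pose L := \sum_(0 <= j < n.+1) r j + \sum_(0 <= j < n.+1 | (1 <= j)%N) l j.
pose X := K * (2 * s ^+ 3).
have X0 : 0 < X by rewrite mulr_gt0.
have low1 (Q : pred nat) : \sum_(1 <= j < n.+1 | Q j) l j =
    \sum_(0 <= j < n.+1 | Q j && (1 <= j)%N) l j.
  exact: big_nat_widenl.
have lzero j : (N0 < j.*2)%N -> l j = 0.
  by move=> Nj; rewrite /l /left_weight leqNgt -/N0 Nj.
have ZE : \sum_(k < n.+1) monomer_weight J h n k = monomer_weight J h n N0 * L.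
  rewrite (sum_weights R n0 xpredT) -/N0 /L; congr (_ * (_ + _)).
  rewrite -(low1 xpredT) big_mkcond; apply: eq_bigr => j _.
  by rewrite andbT; case: leqP => // jN; rewrite lzero.
have W0 : monomer_weight J h n N0 != 0 by rewrite gt_eqF // central_weight_gt0.
have g0 : grid s 0 = 0 by rewrite /grid mul0r.
have gpos j : 0 < grid s j.+1 by rewrite /grid mulr_gt0 ?ltr0n.
have XR : `|X * (\sum_(0 <= j < n.+1) r j) - TR 0| <= C2 * s.
  have := HR 0 xpredT (lexx 0) (fun _ _ => isT) (fun j _ => gpos j).
  by rewrite expr0n /= oppr0 expR0 mulr1.
have XL : `|X * (\sum_(0 <= j < n.+1 | (1 <= j)%N) l j) - TL 0| <= C2 * s.
  have := HL 0 (fun j => (1 <= j)%N) (lexx 0) _ (fun j _ => gpos j).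
  rewrite expr0n /= oppr0 expR0 mulr1; apply.
  by case=> [|j] //; rewrite g0 add0r; move: s3; lra.
have XL1 : `|X * L - 1| <= 2 * C2 * s.
  move: XR XL; rewrite /L mulrDr !ler_norml => /andP[a1 a2] /andP[b1 b2].
  by apply/andP; split; lra.
have L1 : 1 <= L.
  rewrite /L big_nat_recl // {1}/r right_weight0 -addrA lerDl addr_ge0 //.
    by apply: sumr_ge0 => j _; apply: right_weight_ge0.
  by apply: sumr_ge0 => j _; apply: left_weight_ge0.
have cXL : c <= X * L.
  have [small|big] := leP (4 * C2 * s) 1.
    apply: (@le_trans _ _ (1 / 2)); first by rewrite ge_min lexx.
    by move: XL1; rewrite ler_norml => /andP[a _]; lra.
  apply: (@le_trans _ _ X); last by rewrite ler_peMr // ltW.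
  apply: (@le_trans _ _ (2 * K * (4 * C2)^-1 ^+ 3)); first by rewrite ge_min lexx orbT.
  rewrite /X [leRHS]mulrA [2 * K]mulrC ler_wpM2l ?mulr_ge0 ?(ltW K0) //.
  rewrite lerXn2r ?nnegrE ?invr_ge0 ?mulr_ge0 ?(ltW C20) ?(ltW s0) //.
  by rewrite -[leLHS]mul1r ler_pdivrMr ?mulr_gt0 //; lra.
have key A (T : R -> R) z : quartic_tail lam K T -> 0 <= z ->
    `|X * A - T z| <= C2 * s * expR (- z ^+ 2) ->
    `|monomer_weight J h n N0 * A / (monomer_weight J h n N0 * L) - T z| <=
    (C2 + 2 * C2 * C3) / c * s * expR (- z ^+ 2).
  move=> HT z0 XA; rewrite -mulf_div divff // mul1r.
  apply: ratio_comparison XA _ _ => //; first exact: ltW.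
    by case: HT.
  exact: H3.
have jn j : s * grid s j = 2 * j%:R / n%:R by rewrite mulrC (gridE s4).
have jS (j : nat) : j.+1%:R = j%:R + 1 :> R by rewrite -natr1.
split=> z z0.
- rewrite ZE (sum_weights R n0 (fun k => s * z < k%:R / n%:R - m)) -/N0.
  rewrite [\sum_(1 <= j < _ | _) _]big1_seq ?addr0; last first.
    move=> j /andP[/andP[jc zj]]; rewrite mem_index_iota => /andP[j1 _].
    exfalso; move: zj; apply/negP; rewrite -leNgt.
    apply: (@le_trans _ _ 0); last by rewrite mulr_ge0 // ltW.
    rewrite subr_le0 ler_pdivrMr // natrB // -muln2 natrM.
    have : 1 <= j%:R :> R by rewrite -[leLHS]/(1%:R) ler_nat.
    lra.
  apply: key => //; apply: HR => //.
  - move=> j zj; apply: (@lt_le_trans _ _ (s * grid s j)).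
      by rewrite ltr_pM2l //; lra.
    rewrite jn -subr_ge0 natrD -muln2 natrM.
    have -> : (N0%:R + j%:R * 2) / n%:R - m - 2 * j%:R / n%:R = (N0%:R - m * n%:R) / n%:R.
      by field; rewrite gt_eqF.
    by rewrite divr_ge0 ?(ltW nr) // subr_ge0.
  - move=> j zj; rewrite -(ltr_pM2l s0); apply: lt_trans zj _.
    rewrite jn -subr_gt0 natrD -muln2 natrM (jS j).
    have -> : 2 * (j%:R + 1) / n%:R - ((N0%:R + j%:R * 2) / n%:R - m) =
       (m * n%:R + 2 - N0%:R) / n%:R by field; rewrite gt_eqF.
    by rewrite divr_gt0 // subr_gt0.
rewrite ZE (sum_weights R n0 (fun k => k%:R / n%:R - m <= - (s * z))) -/N0.
rewrite big1_seq ?add0r; last first.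
  move=> j /andP[zj _].
  exfalso; move: zj; apply/negP; rewrite -ltNge.
  apply: (@lt_le_trans _ _ 0); first by rewrite oppr_lt0 mulr_gt0.
  rewrite subr_ge0 ler_pdivlMr // natrD.
  have : 0 <= j.*2%:R :> R by [].
  lra.
(* The condition j.*2 <= N0 may be dropped, since l vanishes otherwise; this
   makes Q hold for all large j. *)
pose Q j := s * z <= m - (N0%:R - 2 * j%:R) / n%:R.
have -> : \sum_(1 <= j < n.+1 | (j.*2 <= N0)%N && ((N0 - j.*2)%N%:R / n%:R - m <= - (s * z))) l j
   = \sum_(0 <= j < n.+1 | Q j) l j.
  rewrite low1 big_mkcond [RHS]big_mkcond; apply: eq_bigr => j _.
  have [jN|jN] := leqP j.*2 N0; last first.
    by rewrite lzero //= if_same.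
  rewrite natrB // -muln2 natrM /= -lerN2 opprK opprB [j%:R * 2]mulrC -/(Q j).
  case: j jN => [|j] _; last by rewrite andbT.
  rewrite andbF ifF //; apply/negP; rewrite /Q mulr0 subr0.
  apply/negP; rewrite -ltNge; apply: (@le_lt_trans _ _ 0); last by rewrite mulr_gt0.
  by rewrite subr_le0 ler_pdivlMr.
apply: key => //; first exact: ltW.
apply: HL => //; first exact: ltW.
- move=> j zj; rewrite /Q.
  have : s * (z + 2 * s ^+ 3) < s * grid s j by rewrite ltr_pM2l.
  rewrite jn mulrDr (_ : s * (2 * s ^+ 3) = 2 * s ^+ 4); last by ring.
  rewrite s4 => zj'.
  have -> : m - (N0%:R - 2 * j%:R) / n%:R =
      2 * j%:R / n%:R - 2 / n%:R + (m * n%:R + 2 - N0%:R) / n%:R.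
    by field; rewrite gt_eqF.
  have : 0 <= (m * n%:R + 2 - N0%:R) / n%:R by rewrite divr_ge0 ?(ltW nr) //; lra.
  lra.
- move=> j zj; rewrite -(ltr_pM2l s0); apply: le_lt_trans zj _.
  rewrite jn -subr_gt0 (jS j).
  have -> : 2 * (j%:R + 1) / n%:R - (m - (N0%:R - 2 * j%:R) / n%:R) =
    (N0%:R - m * n%:R + 2) / n%:R by field; rewrite gt_eqF.
  by rewrite divr_gt0 //; lra.
Qed.

(** Non-uniform comparison of the distribution functions with a Gaussian factor. *)
Lemma gibbs_cdf_comparison : 0 < @quartic_const R -> exists2 C : R, 0 < C &
  forall (d : measure_display) (T : measurableType d) (P : probability T R)
    (Y : {RV P >-> R}), has_density Y (@quartic_density R) ->
  forall n : nat, (1 <= n)%N -> forall z : R,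
  `| gibbs_prob J h [pred s : config n | n%:R `^ (1 / 4) * (magnetization R s - m) <= z]
     - fine (cdf Y z) | <= C * (n%:R `^ (1 / 4))^-1 * expR (- z ^+ 2).
Proof.
move=> K0; have [C C0 H] := weights_vs_tails K0.
exists C => // d T P Y densY n n1 z.
have nr : 1 <= n%:R :> R by rewrite -[leLHS]/(1%:R) ler_nat.
set N4 := n%:R `^ (1 / 4).
have N40 : 0 < N4 by rewrite powR_gt0 //; lra.
have s0 : 0 < N4^-1 by rewrite invr_gt0.
have N41 : 1 <= N4 by rewrite -(powRr0 n%:R) ler_powR.
have s1 : N4^-1 <= 1 by rewrite invf_le1.
have s4 : N4^-1 ^+ 4 = n%:R^-1.
  rewrite exprVn /N4 -powR_mulrn ?powR_ge0 // -powRrM.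
  by rewrite (_ : 1 / 4 * 4%:R = 1) ?powRr1 //; field.
have TT : 1 - fine (cdf Y 0) + fine (cdf Y (- 0)) = 1 by rewrite oppr0 subrK.
have [HR HL] := H _ _ (right_tail densY) (left_tail densY) TT n _ n1 s0 s1 s4.
pose E (k : nat) := k%:R / n%:R - m <= N4^-1 * z.
have -> : gibbs_prob J h [pred s : config n | N4 * (magnetization R s - m) <= z] =
  gibbs_prob J h [pred s : config n | E #|monomer_support s|].
  apply: eq_bigl => s; rewrite /= /E magnetizationE.
  by rewrite [N4^-1 * z]mulrC ler_pdivlMr // mulrC.
rewrite gibbs_probE.
have Z0 : 0 < \sum_(k < n.+1) monomer_weight J h n k.
  have [cn co _ _] := centralP R n1.
  rewrite (bigD1 (inord (central R n1))) //= inordK //.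
  by rewrite ltr_pwDl ?monomer_weight_gt0 // sumr_ge0 // => k _; apply: monomer_weight_ge0.
have [z0|z0] := leP 0 z.
  have := HR z z0.
  have -> : \sum_(k < n.+1 | N4^-1 * z < k%:R / n%:R - m) monomer_weight J h n k =
      \sum_(k < n.+1) monomer_weight J h n k - \sum_(k < n.+1 | E k) monomer_weight J h n k.
    rewrite [X in _ = X - _](bigID (fun k : 'I_n.+1 => E k)) /= addrAC subrr add0r.
    by apply: eq_bigl => k; rewrite /E ltNge.
  rewrite mulrBl divff ?gt_eqF // opprB addrA -normrN.
  by apply: le_trans; rewrite le_eqVlt; apply/orP; left; apply/eqP; congr (`| _ |); ring.
have := HL (- z); rewrite sqrrN mulrN !opprK; apply.
by rewrite oppr_gt0.
Qed.

(** Upper bound for p ln (1 + |z|) - z^2: by concavity of the logarithm,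
    ln ((1 + |z|)^2 / p) <= (1 + |z|)^2 / p - 1, and (1 + |z|)^2 <= 2 (1 + z^2). *)
Lemma gaussian_power_bound (C p z : R) : 0 < C -> 3 <= p ->
  C * expR (- z ^+ 2) <=
  ((1 + C) * expR 1) `^ p * p `^ (p / 2) / (1 + `|z|) `^ p.
Proof.
move=> C0 p3.
have p0 : 0 < p by lra.
have z1 : 0 < 1 + `|z| by rewrite ltr_pwDl.
rewrite ler_pdivlMr ?powR_gt0 //.
have zsq : (1 + `|z|) ^+ 2 <= 2 * (1 + z ^+ 2).
  have : 0 <= (1 - `|z|) ^+ 2 by rewrite sqr_ge0.
  have : `|z| ^+ 2 = z ^+ 2 by rewrite -normrX ger0_norm ?sqr_ge0.
  lra.
have lnz : p * ln (1 + `|z|) - z ^+ 2 <= 1 + p / 2 * ln p.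
  have y0 : 0 < (1 + `|z|) ^+ 2 / p by rewrite divr_gt0 ?exprn_gt0.
  have ly : ln ((1 + `|z|) ^+ 2 / p) <= (1 + `|z|) ^+ 2 / p - 1.
    rewrite -[X in ln X](subrK 1) addrC; apply: le_ln1Dx; lra.
  rewrite ln_div ?posrE ?exprn_gt0 // (lnXn 2 z1) -mulr_natl in ly.
  have : p / 2 * (2 * ln (1 + `|z|) - ln p) <= p / 2 * ((1 + `|z|) ^+ 2 / p - 1).
    by rewrite ler_wpM2l // divr_ge0 // ltW.
  rewrite (_ : p / 2 * (_ / p - 1) = (1 + `|z|) ^+ 2 / 2 - p / 2); last by field; rewrite gt_eqF.
  lra.
have powE (a b : R) : 0 < a -> a `^ b = expR (b * ln a).
  by move=> a0; rewrite /powR gt_eqF.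
rewrite (powE (1 + `|z|)) // (powE p) //.
rewrite -[leLHS]mulrA -expRD.
apply: (@le_trans _ _ (C * (expR 1 * expR (p / 2 * ln p)))).
  by rewrite ler_wpM2l ?(ltW C0) // -expRD ler_expR; lra.
rewrite mulrA ler_wpM2r ?expR_ge0 //.
have B1 : 1 <= (1 + C) * expR 1.
  by rewrite mulr_ege1 //; [lra|rewrite -expR0 ler_expR].
apply: (@le_trans _ _ ((1 + C) * expR 1)); first by rewrite ler_wpM2r ?expR_ge0 //; lra.
by apply: le1r_powR => //; lra.
Qed.

End Assembly.

Theorem theorem4p2 (R : realType) :
  exists B : R, 0 < B /\
    forall (d : measure_display) (T : measurableType d) (P : probability T R)
      (Y : {RV P >-> R}),
    has_density Y (@quartic_density R) ->
    forall n : nat, (1 <= n)%N ->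
    forall p : R, 3 <= p ->
    forall z : R,
      `| gibbs_prob J_c h_c
           [pred s : config n |
              n%:R `^ (1 / 4) * (magnetization R s - m_c) <= z]
         - fine (P [set w | Y w <= z]) |
      <= (B `^ p * p `^ (p / 2)) / ((1 + `|z|) `^ p * n%:R `^ (1 / 4)).
Proof.
have [K0|K0] := ltP 0 (@quartic_const R); last first.
  (* No random variable has the prescribed density when K <= 0. *)
  exists 1; split=> // d T P Y densY.
  by have := quartic_const_gt0 densY; rewrite ltNge K0.
have [C C0 H] := gibbs_cdf_comparison K0.
exists ((1 + C) * expR 1); split; first by rewrite mulr_gt0 ?expR_gt0 //; lra.
move=> d T P Y densY n n1 p p3 z.
have -> : P [set w | Y w <= z] = cdf Y z.
  by rewrite /cdf /distribution /pushforward; congr (P _).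
apply: le_trans (H d T P Y densY n n1 z) _.
rewrite invfM mulrA mulrAC ler_wpM2r ?invr_ge0 ?powR_ge0 //.
exact: gaussian_power_bound.
Qed.
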